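(* Let $a,b,d$ be three pairwise coprime integers with $1<\min(a,b)<d$, $d\nmid ab-a-b$ and $d\notin\langle a,b\rangle$, and let $S=\langle a,b\rangle/d$. Let $m\in\{1,\dots,d-1\}$ with $am+b\equiv0\pmod d$, $\alpha=m/d$ with continued fraction expansion $[0,a_1,\dots,a_r,1]$ and convergents $p_k/q_k$. Let $\tau=\frac{am+b}{d}$, $\beta=\{a\alpha\}=1-\{b/d\}$ with $\alpha$-numeration $(b_1,\dots,b_s)$, $b_s>0$, and $\mu_i=\tau q_i-ap_i$ for $i\in\{0,\dots,r\}$. Let $B=\{i\in\{1,\dots,\lfloor s/2\rfloor\}: b_{2i}\neq0\}$, and $k_0=(s+1)/2$ if $B=\emptyset$, $k_0=\min B$ otherwise. Let $\mathcal F_0=\{a\lfloor b/d\rfloor-\tau\}$ if $\alpha<\beta$ and $\mathcal F_0=\emptyset$ otherwise; $\mathcal F_1=\{a\lfloor b/d\rfloor-\mu_{2k-2}-j\mu_{2k-1}: k\in\{1,\dots,k_0-1\},\ j\in\{1,\dots,a_{2k}\}\}$; $\mathcal F_2=\{a\lfloor b/d\rfloor+a-j\mu_{2k-1}-\sum_{i=1}^{2k-1}b_i\mu_{i-1}: k\in B,\ j\in\{0,\dots,b_{2k}-1\}\}$. Case 1: if $a<d<b$, then $\mathrm{PF}(S)$ is the disjoint union $\mathcal F_0\sqcup\mathcal F_1\sqcup\mathcal F_2$ and $t(S)=\sum_{k=1}^{k_0-1}a_{2k}+\sum_{k=k_0}^{\lfloor s/2\rfloor}b_{2k}+\mathbf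 1_{\alpha<\beta}$. Case 2: if $d>\max(a,b)$, then $\mathrm{PF}(S)=\mathcal F_2$ and $t(S)=\sum_{k=k_0}^{\lfloor s/2\rfloor}b_{2k}$.
   Context: $\langle a,b\rangle=\{xa+yb:x,y\in\mathbb{N}\}$; $S/d=\{x\in\mathbb{N}:dx\in S\}$; $\mathrm{PF}(S)=\{x\in\mathbb{Z}\setminus S: x+s\in S\text{ for all nonzero }s\in S\}$, $t(S)=\#\mathrm{PF}(S)$; $\{x\}$ and $\lfloor x\rfloor$ are fractional and integer parts; $\mathbf 1$ is the indicator. Continued fractions: $\alpha=[0,a_1,\dots,a_r,1]$ is the expansion of the rational $\alpha\in(0,1)$ with last partial quotient $1$; with $a_0=0$, $p_{-2}=0,p_{-1}=1,q_{-2}=1,q_{-1}=0$, $p_k=a_kp_{k-1}+p_{k-2}$, $q_k=a_kq_{k-1}+q_{k-2}$, the convergents are $p_k/q_k$, $q_{r+1}=d$; $\delta_k=(-1)^k(q_k\alpha-p_k)$. $\alpha$-numeration: $E_\alpha$ is the set of $(d_1,\dots,d_r)\in\mathbb{N}^r$ with $d_j\in\{0,\dots,a_j\}$ and such that $d_j=0$ implies either $d_i=0$ for all $i\ge j$ or ($j\ge2$ and $d_{j-1}=a_{j-1}$). Each $\beta\in\{k/d:0\le k<d\}$ has a unique representation $\beta=\sum_{j=1}^r(-1)^{j-1}d_j\delta_{j-1}$ with $(d_j)\in E_\alpha$, its $\alpha$-numeration; writing it $(b_1,\dots,b_s)$ with $b_s>0$ means $s$ is the last index with nonzero entry. *)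

(* Defs.v *)
From HB Require Import structures.
From mathcomp Require Export all_boot all_order all_algebra.
From mathcomp Require Export boolp classical_sets cardinality.

Set Implicit Arguments.
Unset Strict Implicit.
Unset Printing Implicit Defensive.

Import Order.TTheory GRing.Theory Num.Theory.
Local Open Scope classical_set_scope.
Local Open Scope ring_scope.

Definition semigroup2 (a b : nat) : set nat :=
  [set z | exists x y : nat, z = (x * a + y * b)%N].

Definition quot_semigroup (S : set nat) (d : nat) : set nat :=
  [set x | S (d * x)%N].

(* S as a subset of the integers *)
Definition inZ (S : set nat) : set int := [set n%:Z | n in S].

Definition PF (S : set nat) : set int :=
  [set x | ~ inZ S x /\
    forall s : nat, S s -> s <> 0%N -> inZ S (x + s%:Z)].

(* t(S) = n, i.e. PF(S) is finite with exactly n elements *)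
Definition type_is (S : set nat) (n : nat) : Prop := (PF S #= `I_n)%card.

Definition frac (x : rat) : rat := x - (Num.floor x)%:~R.

Fixpoint cf_val (u : seq nat) : rat :=
  match u with
  | [::] => 0
  | [:: x] => x%:R
  | x :: v => x%:R + (cf_val v)^-1
  end.

(* A = [:: a_1; ...; a_r]; alpha = [0, a_1, ..., a_r, 1] *)
Definition is_cf (alpha : rat) (A : seq nat) : Prop :=
  all (fun x => 0 < x)%N A /\ alpha = cf_val (0%N :: rcons A 1%N).

(* a_k, including a_0 = 0 and a_(r+1) = 1 *)
Definition pquot (A : seq nat) (k : nat) : nat :=
  nth 0%N (0%N :: rcons A 1%N) k.

(* Indices are shifted by 2: convp_shift A n = p_(n-2), convq_shift A n = q_(n-2). *)
Fixpoint convp_shift (A : seq nat) (n : nat) : nat :=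
  match n with
  | 0 => 0
  | 1 => 1
  | (k.+1 as k1).+1 => pquot A k * convp_shift A k1 + convp_shift A k
  end%N.

Fixpoint convq_shift (A : seq nat) (n : nat) : nat :=
  match n with
  | 0 => 1
  | 1 => 0
  | (k.+1 as k1).+1 => pquot A k * convq_shift A k1 + convq_shift A k
  end%N.

Definition convp A k := convp_shift A k.+2.
Definition convq A k := convq_shift A k.+2.

Definition delta (A : seq nat) (alpha : rat) (k : nat) : rat :=
  (-1) ^+ k * ((convq A k)%:R * alpha - (convp A k)%:R).

(* 1-based entries of D = [:: d_1; ...; d_r]; digit D i = 0 for i = 0 or i > r. *)
Definition digit (D : seq nat) (i : nat) : nat := nth 0%N (0%N :: D) i.

Definition Ealpha (A : seq nat) : set (seq nat) :=
  [set D | size D = size A /\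
    forall j : nat, (1 <= j <= size A)%N ->
      (digit D j <= pquot A j)%N /\
      (digit D j = 0%N ->
         (forall i : nat, (j <= i <= size A)%N -> digit D i = 0%N) \/
         ((2 <= j)%N /\ digit D j.-1 = pquot A j.-1))].

Definition is_numeration (A : seq nat) (alpha beta : rat) (D : seq nat) : Prop :=
  Ealpha A D /\
  beta = \sum_(1 <= j < (size A).+1)
            (-1) ^+ j.-1 * (digit D j)%:R * delta A alpha j.-1.

Definition last_nonzero (D : seq nat) (s : nat) : Prop :=
  (0 < digit D s)%N /\ forall i : nat, (s < i)%N -> digit D i = 0%N.

(* tau = (a m + b) / d, an exact division when a m + b = 0 mod d *)
Definition tau (a b d m : nat) : nat := ((a * m + b) %/ d)%N.

Definition mu (a b d m : nat) (A : seq nat) (i : nat) : int :=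
  (tau a b d m)%:Z * (convq A i)%:Z - a%:Z * (convp A i)%:Z.

Definition Bset (D : seq nat) (s : nat) : seq nat :=
  [seq i <- iota 1 (s %/ 2) | digit D (2 * i) != 0%N].

(* If Bset D s is empty then s is odd, since b_s > 0; (s + 1) / 2 is then exact. *)
Definition k0 (D : seq nat) (s : nat) : nat :=
  if Bset D s is i :: B' then \big[minn/i]_(j <- B') j else ((s + 1) %/ 2)%N.

Definition abd (a b d : nat) : int := a%:Z * Num.floor (b%:R / d%:R : rat).

Definition F0 (a b d m : nat) (alpha beta : rat) : set int :=
  [set x | alpha < beta /\ x = abd a b d - (tau a b d m)%:Z].

Definition F1 (a b d m : nat) (A D : seq nat) (s : nat) : set int :=
  [set x | exists k j : nat,
    [/\ (1 <= k < k0 D s)%N, (1 <= j <= pquot A (2 * k))%N &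
        x = abd a b d - mu a b d m A (2 * k - 2)
              - j%:Z * mu a b d m A (2 * k - 1)]].

Definition F2 (a b d m : nat) (A D : seq nat) (s : nat) : set int :=
  [set x | exists k j : nat,
    [/\ k \in Bset D s, (j < digit D (2 * k))%N &
        x = abd a b d + a%:Z - j%:Z * mu a b d m A (2 * k - 1)
              - \sum_(1 <= i < (2 * k)%N) (digit D i)%:Z * mu a b d m A i.-1]].

(* Main.v *)
Require Import Defs.
From mathcomp Require Import zify ring lra.
Import Order.TTheory GRing.Theory Num.Theory.
Local Open Scope classical_set_scope.
Local Open Scope ring_scope.

(** Write x in Z as tau (a - n) - a (kap - k), where kap = floor (a alpha) and
    1 <= n <= a; this is possible in exactly one way because tau is prime to a.
    Put y (n, k) = n m - k d and be = y (a, kap) = d beta.  Membership in S is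
    then a sign condition on y, and x is pseudo-Frobenius (up to an extra
    condition when b < d) if and only if be < y (n, k) <= be + d and (n, k) is a
    strict record: every lattice point (n1, k1) with 1 <= n1 < n and y > be lies
    strictly higher.

    These inhomogeneous records are read off the Ostrowski expansion
    a = sum b_i q_(i-1), be = sum b_i (q_(i-1) m - p_(i-1) d).  Writing a lattice
    point in the unimodular basis of two consecutive convergents and comparing
    signs bounds its height from below, and the partial sums of the expansion
    show where the bound is attained: the records with y < d are the partial
    sums stopped inside an even-indexed digit (F2), those with y >= d are the
    records of the homogeneous problem be = 0 (F0 and F1).  When b < d, a record
    with y >= d would be a negative pseudo-Frobenius number, which forces 1 in S,
    that is, d in <a, b>. *)

(** * Records of a linear form above a threshold *)

Definition lattice_height (m d n k : int) : int := n * m - k * d.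

Definition record_at (m d be n k : int) :=
  forall n1 k1, 1 <= n1 < n -> be < lattice_height m d n1 k1 ->
    lattice_height m d n k < lattice_height m d n1 k1.

Definition record_point (m d a be n k : int) :=
  [/\ 1 <= n <= a, be < lattice_height m d n k <= be + d &
      record_at m d be n k].

Definition digit_sum (b : nat -> nat) (F : nat -> int) (t : nat) : int :=
  \sum_(1 <= i < t.+1) (b i)%:Z * F i.

Lemma digit_sum0 b F : digit_sum b F 0 = 0.
Proof. by rewrite /digit_sum big_geq. Qed.

Lemma digit_sumS b F t :
  digit_sum b F t.+1 = digit_sum b F t + (b t.+1)%:Z * F t.+1.
Proof. by rewrite /digit_sum big_nat_recr. Qed.

Lemma step_locate (n x q : int) (l : nat) : 0 < q ->
  x <= n < x + l%:Z * q ->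
  exists2 j : nat, (j < l)%N & x + j%:Z * q <= n < x + j.+1%:Z * q.
Proof.
move=> q0; elim: l => [|l IH] h; first by lia.
have [h1|h1] := ltrP n (x + l%:Z * q).
  have [|j jl hj] := IH; first by lia.
  by exists j => //; lia.
by exists l => //; lia.
Qed.

Section InhomogeneousRecords.

(* Indices are shifted by one: [Q i] and [P i] stand for q_(i-1) and p_(i-1), so
   that the digit [b i] is paired with [Q i]; [c i] stands for a_i, and [T] below
   for 2 k_0 - 1. *)
Variables (r : nat) (c : nat -> nat) (Q : nat -> int).
Hypotheses (Q0 : Q 0 = 0) (Q1 : Q 1 = 1).
Hypothesis QS : forall i, Q i.+2 = (c i.+1)%:Z * Q i.+1 + Q i.
Hypothesis c_gt0 : forall i, (1 <= i <= r.+1)%N -> (0 < c i)%N.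

Lemma Q_gt0 i : (i <= r.+1)%N -> 0 <= Q i /\ 0 < Q i.+1.
Proof.
elim: i => [|i IH] ile; first by rewrite Q0 Q1.
have [q0 q1] := IH (ltnW ile); have := @c_gt0 i.+1 ile.
by rewrite QS; nia.
Qed.

Lemma Q_pos i : (0 < i <= r.+1)%N -> 0 < Q i.
Proof. by case: i => // i /andP[_ ile]; have [] := Q_gt0 i (ltnW ile). Qed.

Lemma Q_mono i j : (0 < i <= j)%N && (j <= r.+1)%N -> Q i <= Q j.
Proof.
elim: j => [|j IH] hij; first by lia.
have [->//|ij] := eqVneq i j.+1.
apply: (le_trans (IH _)); first by lia.
case: j {IH} hij ij => [|j] hij ij; first by lia.
have [q0 q1] := Q_gt0 j ltac:(lia); have := c_gt0 j.+1 ltac:(lia).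
by rewrite QS; nia.
Qed.

(** * Distinctness of the abscissas of the candidate records *)

Lemma low_point_inj t j t' j' : odd t -> odd t' -> (t < r)%N -> (t' < r)%N ->
  (1 <= j <= c t.+1)%N -> (1 <= j' <= c t'.+1)%N ->
  Q t + j%:Z * Q t.+1 = Q t' + j'%:Z * Q t'.+1 -> t = t' /\ j = j'.
Proof.
(* Odd indices differ by at least two, so [Q t1 + j1 * Q t1.+1 <= Q t1.+2 <= Q t2]: the abscissas
   increase lexicographically in [(t, j)]. *)
have lt_t t1 j1 t2 j2 : odd t1 -> odd t2 -> (t1 < t2)%N -> (t2 < r)%N ->
  (1 <= j1 <= c t1.+1)%N -> (1 <= j2)%N ->
  Q t1 + j1%:Z * Q t1.+1 < Q t2 + j2%:Z * Q t2.+1.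
  move=> o1 o2 tt ts jb jb2; have := Q_mono t1.+2 t2 ltac:(lia).
  have [_ q1] := Q_gt0 t1 ltac:(lia); have [_ q2] := Q_gt0 t2 ltac:(lia).
  by rewrite QS; nia.
move=> ot ot' ts ts' jb jb' E.
have [tt|tt|tt] := ltngtP t t'.
- by have := lt_t t j t' j' ot ot' tt ts' jb; lia.
- by have := lt_t t' j' t j ot' ot tt ts jb'; lia.
by split=> //; subst t'; have [_ q1] := Q_gt0 t ltac:(lia); nia.
Qed.

Lemma low_pair_inj k j k' j' : (0 < k)%N -> (0 < k')%N ->
  (2 * k <= r)%N -> (2 * k' <= r)%N ->
  (1 <= j <= c (2 * k))%N -> (1 <= j' <= c (2 * k'))%N ->
  Q (2 * k).-1 + j%:Z * Q (2 * k) = Q (2 * k').-1 + j'%:Z * Q (2 * k') ->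
  k = k' /\ j = j'.
Proof.
move=> k0 k0' kr kr' jc jc'; have := low_point_inj (2 * k).-1 j (2 * k').-1 j'.
have -> : (2 * k).-1.+1 = (2 * k)%N by lia.
have -> : (2 * k').-1.+1 = (2 * k')%N by lia.
by move=> h E; have [] := h ltac:(lia) ltac:(lia) ltac:(lia) ltac:(lia) jc jc' E; lia.
Qed.

Variables (s : nat) (b : nat -> nat).
Hypothesis s_le : (s <= r)%N.

Local Notation psum := (digit_sum b).

Let N := psum Q.

Let NS t : N t.+1 = N t + (b t.+1)%:Z * Q t.+1.
Proof. exact: digit_sumS. Qed.

Lemma psumQ_mono t u : (t <= u <= s)%N -> N t <= N u.
Proof.
elim: u => [|u IH] h; first by have -> : t = 0%N by lia.
have [->//|tu] := eqVneq t u.+1.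
have := IH ltac:(lia); have [] := Q_gt0 u ltac:(lia).
rewrite NS; nia.
Qed.

Lemma high_point_inj t j t' j' : odd t -> odd t' -> (t < s)%N -> (t' < s)%N ->
  (j < b t.+1)%N -> (j' < b t'.+1)%N ->
  N t + j%:Z * Q t.+1 = N t' + j'%:Z * Q t'.+1 -> t = t' /\ j = j'.
Proof.
(* As [j1 < b t1.+1], the stopped sum stays below the completed sum [N t1.+1], itself at most
   [N t2]. *)
have lt_t t1 j1 t2 j2 : (t1 < t2)%N -> (t2 < s)%N -> (j1 < b t1.+1)%N ->
  N t1 + j1%:Z * Q t1.+1 < N t2 + j2%:Z * Q t2.+1.
  move=> tt ts jb; have := psumQ_mono t1.+1 t2 ltac:(lia).
  have [_ q1] := Q_gt0 t1 ltac:(lia); have [_ q2] := Q_gt0 t2 ltac:(lia).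
  by rewrite NS; nia.
move=> ot ot' ts ts' jb jb' E.
have [tt|tt|tt] := ltngtP t t'.
- by have := lt_t t j t' j' tt ts' jb; lia.
- by have := lt_t t' j' t j tt ts jb'; lia.
by split=> //; subst t'; have [_ q1] := Q_gt0 t ltac:(lia); nia.
Qed.

Lemma high_pair_inj k j k' j' : (0 < k)%N -> (0 < k')%N ->
  (2 * k <= s)%N -> (2 * k' <= s)%N ->
  (j < b (2 * k))%N -> (j' < b (2 * k'))%N ->
  N (2 * k).-1 + j%:Z * Q (2 * k) = N (2 * k').-1 + j'%:Z * Q (2 * k') ->
  k = k' /\ j = j'.
Proof.
move=> k0 k0' ks ks' jb jb'; have := high_point_inj (2 * k).-1 j (2 * k').-1 j'.
have -> : (2 * k).-1.+1 = (2 * k)%N by lia.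
have -> : (2 * k').-1.+1 = (2 * k')%N by lia.
by move=> h E; have [] := h ltac:(lia) ltac:(lia) ltac:(lia) ltac:(lia) jb jb' E; lia.
Qed.

Hypothesis b_le : forall i, (1 <= i <= s)%N -> (b i <= c i)%N.

Lemma psumQ_lt t : (t <= s)%N -> 0 <= N t < Q t + Q t.+1.
Proof.
elim: t => [|t IH] tle; first by rewrite /N digit_sum0 Q0 Q1.
have [q0 q1] := @Q_gt0 t (leqW (leq_trans (ltnW tle) s_le)).
have := @b_le t.+1 tle; have := IH (ltnW tle).
by rewrite QS NS; nia.
Qed.

(** * Lattice points in the basis of two consecutive convergents *)

Variables (m d : int) (P : nat -> int).
Hypotheses (P0 : P 0 = 1) (P1 : P 1 = 0).
Hypothesis PS : forall i, P i.+2 = (c i.+1)%:Z * P i.+1 + P i.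

Local Notation height := (lattice_height m d).
Let H (i : nat) : int := height (Q i) (P i).
Let K := psum P.
Let be := psum H s.

Let HS i : H i.+2 = (c i.+1)%:Z * H i.+1 + H i.
Proof. by rewrite /H /lattice_height QS PS; ring. Qed.

Lemma height_psum t : height (psum Q t) (psum P t) = psum H t.
Proof.
elim: t => [|t IH]; first by rewrite !digit_sum0 /lattice_height; ring.
by rewrite !digit_sumS -IH /H /lattice_height; ring.
Qed.

Lemma convergent_det i : Q i.+1 * P i - Q i * P i.+1 = (-1) ^+ i.
Proof.
elim: i => [|i IH]; first by rewrite Q0 Q1 P0 P1 expr0.
by rewrite exprS -IH QS PS; ring.
Qed.

(** The determinant of two consecutive convergents is a sign, so they form a basis of the lattice;
    [x] and [z] come from Cramer's rule. *)
Lemma lattice_coord i n k : exists x z : int,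
  n = x * Q i + z * Q i.+1 /\ height n k = x * H i + z * H i.+1.
Proof.
have eD : (-1) ^+ i * (Q i.+1 * P i - Q i * P i.+1) = 1.
  by rewrite convergent_det -expr2 sqrr_sign.
set e := (-1) ^+ i in eD.
have E1 : n = (e * (Q i.+1 * k - P i.+1 * n)) * Q i
            + (e * (P i * n - Q i * k)) * Q i.+1.
  by rewrite -[LHS]mul1r -eD; ring.
have E2 : k = (e * (Q i.+1 * k - P i.+1 * n)) * P i
            + (e * (P i * n - Q i * k)) * P i.+1.
  by rewrite -[LHS]mul1r -eD; ring.
move: (e * _) (e * _) E1 E2 => z x E1 E2; exists x, z; split=> //.
by rewrite /H /lattice_height E1 E2; ring.
Qed.

(** * Height bounds from the alternating signs of the convergents *)

Hypothesis H_odd : forall i, odd i -> (i <= r.+1)%N -> 0 < H i.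
Hypothesis H_even : forall i, ~~ odd i -> (i <= r.+1)%N -> H i < 0.

(** The determinant identity writes [d] as [Q s.+1 * |H s| + Q s * |H s.+1|] with both absolute
    values at least 1, hence [d >= Q s + Q s.+1 > N s]. *)
Lemma psumQ_lt_d : 0 <= N s < d.
Proof.
have /andP[-> Ns] := psumQ_lt s (leqnn s); apply: (lt_le_trans Ns).
have [q0 q1] := Q_gt0 s ltac:(lia).
have E : Q s.+1 * H s - Q s * H s.+1 = - (-1) ^+ s * d.
  by rewrite -convergent_det /H /lattice_height; ring.
have := H_odd s; have := H_even s; have := H_odd s.+1; have := H_even s.+1.
move: E; rewrite -signr_odd /=; case: (odd s) => /= E h1 h2 h3 h4.
  by have := h1 isT ltac:(lia); have := h4 isT ltac:(lia); nia.
by have := h2 isT ltac:(lia); have := h3 isT ltac:(lia); nia.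
Qed.

(** Downward induction from [t = s], where the tail is zero; each step adds a height of known sign,
    multiplied by a digit between 0 and the partial quotient. *)
Lemma tail_bounds t : (t <= s)%N ->
  if odd t then - H t < be - psum H t < - H t.+1
  else - H t.+1 < be - psum H t < - H t.
Proof.
move=> tle; rewrite -(subKn tle); move: (s - t)%N (leq_subr t s) => u.
elim: u => [|u IH] ule.
  rewrite subn0 /be subrr; case: ifP => os.
    by have := H_odd s os (leqW s_le); have := H_even s.+1; rewrite /= os; lia.
  by have := H_even s (negbT os) (leqW s_le); have := H_odd s.+1;
    rewrite /= os; lia.
have := IH (ltnW ule).
have -> : (s - u = (s - u.+1).+1)%N by lia.
move: (s - u.+1)%N (ltn_subrL u.+1 s) => v.
move=> vs; have vlt : (v < s)%N by lia.
have vr : (v < r.+1)%N by lia.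
have := @b_le v.+1 vlt; rewrite HS digit_sumS /=.
have := H_odd v.+1; have := H_even v.+1; rewrite /=.
case: (odd v) => /= h1 h2.
  by have := h1 isT vr; nia.
by have := h2 isT vr; nia.
Qed.

(** Take coordinates about [(N t - Q t, K t - P t)], whose height is the bound. The signs settle
    [x <= 0 <= z]; [x <= 0] with [z < 0] forces [n <= 0]; and [x > 0] forces [z < b t.+1], so the
    height is at most [psum H t.+1 - H t.+1 < be]. *)
Lemma lower_odd_step t n k : ~~ odd t -> (t < s)%N -> 1 <= n < N t.+1 ->
  be < height n k -> psum H t - H t <= height n k.
Proof.
move=> ot tlt; rewrite NS => /andP[n1 n2].
have [x [z [En Ey]]] := lattice_coord t (n - (N t - Q t)) (k - (K t - P t)).
have -> : height n k = psum H t - H t + (x * H t + z * H t.+1).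
  by rewrite -Ey -height_psum /H /lattice_height /N /K; ring.
have ht0 := @H_even t ot (leqW (leq_trans (ltnW tlt) s_le)).
have ht1 := @H_odd t.+1 ot (leqW (leq_trans tlt s_le)).
have [q0 q1] := @Q_gt0 t (leqW (leq_trans (ltnW tlt) s_le)).
have /andP[N0 N1] := @psumQ_lt t (ltnW tlt).
have := @tail_bounds t.+1 tlt; rewrite /= ot digit_sumS => /andP[tb1 tb2] hy.
have [x0|x0] := lerP x 0.
  have [z0|z0] := lerP 0 z; first by nia.
  have : x * Q t <= 0 by nia.
  have : z * Q t.+1 <= 0 by nia.
  nia.
have : z < (b t.+1)%:Z by nia.
nia.
Qed.

(** Coordinates are taken about [(N t, K t)]. For [x >= 0] the bound on [n] gives [z <= j]. For
    [x < 0], positivity of [n] gives [z >= 0], and the height is at most [psum H t - H t < be]. *)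
Lemma lower_even_step t j n k : odd t -> (t < s)%N -> (j < b t.+1)%N ->
  1 <= n < N t + j.+1%:Z * Q t.+1 ->
  be < height n k -> psum H t + j%:Z * H t.+1 <= height n k.
Proof.
move=> ot tlt jb /andP[n1 n2].
have [x [z [En Ey]]] := lattice_coord t (n - N t) (k - K t).
have -> : height n k = psum H t + (x * H t + z * H t.+1).
  by rewrite -Ey -height_psum /H /lattice_height /N /K; ring.
have ht0 := @H_odd t ot (leqW (leq_trans (ltnW tlt) s_le)).
have ht1 : H t.+1 < 0.
  by apply: H_even; rewrite /= ?ot // (leqW (leq_trans tlt s_le)).
have [q0 q1] := @Q_gt0 t (leqW (leq_trans (ltnW tlt) s_le)).
have /andP[N0 N1] := @psumQ_lt t (ltnW tlt).
have := @tail_bounds t (ltnW tlt); rewrite /= ot => /andP[tb1 tb2] hy.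
have [x0|x0] := lerP 0 x.
  have : z < j.+1%:Z by nia.
  nia.
have : - Q t.+1 < z * Q t.+1 by nia.
move=> h; have : -1 < z by nia.
nia.
Qed.

(** This is the analogue for threshold 0, with coordinates about the origin: [x <= 0] and a
    nonnegative height give [z <= 0], hence [n <= 0]. *)
Lemma lower_homogeneous t j n k : odd t -> (t <= r)%N -> (j < c t.+1)%N ->
  1 <= n < Q t + j.+1%:Z * Q t.+1 ->
  0 <= height n k -> H t + j%:Z * H t.+1 <= height n k.
Proof.
move=> ot tlt jb /andP[n1 n2].
have [x [z [En ->]]] := lattice_coord t n k.
have ht0 := @H_odd t ot (leqW tlt).
have ht1 : H t.+1 < 0 by apply: H_even; rewrite /= ?ot.
have [q0 q1] := @Q_gt0 t (leqW tlt) => hy.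
have [x0|x0] := lerP 1 x.
  have : z < j.+1%:Z by nia.
  nia.
have : z <= 0 by nia.
nia.
Qed.

(** * Classification of the records *)

Hypothesis b_zero : forall i, (1 <= i <= s)%N -> b i = 0%N ->
  (2 <= i)%N /\ b i.-1 = c i.-1.
Hypothesis m_bounds : 0 < m < d.
Hypothesis be_bounds : 0 <= be < d.
Hypothesis m_neq : m <> be.
Hypothesis N_gt1 : 1 < N s.

Variable T : nat.
Hypotheses (T_odd : odd T) (T_le : (T <= s)%N).
Hypothesis b_even0 : forall i, ~~ odd i -> (1 <= i < T)%N -> b i = 0%N.
Hypothesis b_T1 : (T < s)%N -> (0 < b T.+1)%N.

Lemma multiple_cases (l : int) :
  [\/ l = 0, d <= l * d | l * d <= - d].
Proof.
have [l0|l0] := lerP 1 l; first by apply: Or32; nia.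
by have [->|ln] := eqVneq l 0; [apply: Or31 | apply: Or33; nia].
Qed.

(** For fixed [n] the heights form one residue class modulo [d], which meets a half-open interval of
    length [d] only once. *)
Lemma height_inj n k k' :
  be < height n k <= be + d -> be < height n k' <= be + d -> k = k'.
Proof.
have -> : height n k' = height n k + (k - k') * d by rewrite /lattice_height; ring.
move=> h h'; suff : k - k' = 0 by lia.
by nia.
Qed.

(** A vanishing even digit forces the digit before it to be maximal, so two digits together carry
    [Q t] to [Q t.+2] by the recurrence. The summand [d] comes from [H 0 = - d]. *)
Lemma psum_initial t : ~~ odd t -> (t < T)%N ->
  N t = Q t /\ psum H t = H t + d.
Proof.
have [n] := ubnP t; elim: n t => // n IH [|[|t]] // tn ot tT.
  by rewrite /N !digit_sum0 Q0 /H /lattice_height Q0 P0; split; ring.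
rewrite /= negbK in ot.
have tT' : (t < T)%N by lia.
have tn' : (t < n)%N by lia.
have [IH1 IH2] := IH t tn' ot tT'.
have b2 : b t.+2 = 0%N by apply: b_even0; rewrite /= ?negbK.
have hts : (1 <= t.+2 <= s)%N by lia.
have [_ /= b1] := b_zero t.+2 hts b2.
by rewrite !NS !digit_sumS IH1 IH2 b1 b2 QS HS; split; ring.
Qed.

Lemma b_T_gt0 : (0 < b T)%N.
Proof.
rewrite lt0n; apply/eqP => bT0.
have hT : (1 <= T <= s)%N by lia.
have [T2 bT1] := b_zero T hT bT0.
have h1 : (1 <= T.-1 < T)%N by lia.
have h2 : ~~ odd T.-1 by lia.
have h3 : (1 <= T.-1 <= r.+1)%N by lia.
have := b_even0 _ h2 h1; have := c_gt0 _ h3; lia.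
Qed.

Lemma psum_T : N T = Q T.-1 + (b T)%:Z * Q T /\
  psum H T = H T.-1 + d + (b T)%:Z * H T.
Proof.
have h1 : (T.-1 < T)%N by lia.
have h2 : ~~ odd T.-1 by lia.
have [e1 e2] := psum_initial _ h2 h1.
have ET : T = T.-1.+1 by lia.
by have := NS T.-1; have := digit_sumS b H T.-1; rewrite -ET e1 e2 => -> ->.
Qed.

(** At index [T.-1] the bound of [lower_odd_step] is exactly [d]. This makes [N T] the border
    between the records of height at least [d] and those below [d]. *)
Lemma below_NT n k : 1 <= n < N T -> be < height n k -> d <= height n k.
Proof.
move=> hn hy.
have h1 : (T.-1 < T)%N by lia.
have h2 : ~~ odd T.-1 by lia.
have h3 : (T.-1 < s)%N by lia.
have ET : T = T.-1.+1 by lia.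
rewrite ET in hn.
have := lower_odd_step _ _ _ h2 h3 hn hy.
by have [_ ->] := psum_initial _ h2 h1; lia.
Qed.

Lemma psumH_le t : (t <= s)%N ->
  psum H t <= d + (if odd t then H t.+1 else H t).
Proof.
elim: t => [|t IH] ts; first by rewrite digit_sum0 /H /lattice_height Q0 P0 /=; lia.
have := IH (ltnW ts); have := b_le t.+1 ts.
have := H_odd t.+1; have := H_even t.+1; rewrite digit_sumS HS /=.
have -> : (t < r.+1)%N by lia.
by case: (odd t) => /= h1 h2; [have := h1 isT isT | have := h2 isT isT]; nia.
Qed.

(** Partial sums of the expansion stopped inside the even-indexed digit [t.+1]. The restriction
    [T <= t] loses nothing, since earlier even digits vanish. *)
Definition high_point (n k : int) := exists t j : nat,
  [/\ odd t, (T <= t < s)%N, (j < b t.+1)%N,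
      n = N t + j%:Z * Q t.+1 & k = K t + j%:Z * P t.+1].

(* The shift by -1 in [k] raises the height by [d], which brings it above [be]. *)
Definition low_point (n k : int) := exists t j : nat,
  [/\ odd t, (t < T)%N, (1 <= j <= c t.+1)%N,
      n = Q t + j%:Z * Q t.+1 & k = P t + j%:Z * P t.+1 - 1].

Lemma NT_gt0 : 0 < N T.
Proof.
have [-> _] := psum_T; have := b_T_gt0; have := Q_gt0 T.-1 ltac:(lia).
have -> : T.-1.+1 = T by lia.
by nia.
Qed.

Lemma high_height t j : odd t -> (t < s)%N -> (j < b t.+1)%N ->
  be < psum H t + j%:Z * H t.+1 < d.
Proof.
move=> ot ts jb; have ht : H t.+1 < 0 by apply: H_even; rewrite /= ?ot //; lia.
have := tail_bounds t.+1 ts; rewrite /= ot digit_sumS /=.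
have := psumH_le t (ltnW ts); rewrite ot; nia.
Qed.

Lemma height_step t j :
  height (N t + j%:Z * Q t.+1) (K t + j%:Z * P t.+1) = psum H t + j%:Z * H t.+1.
Proof. by rewrite -height_psum /H /lattice_height /N /K; ring. Qed.

Lemma high_point_record n k :
  high_point n k -> record_point m d (N s) be n k /\ height n k < d.
Proof.
move=> [t [j [ot /andP[Tt ts] jb -> ->]]].
have hh := high_height _ _ ot ts jb.
have [q0 q1] := Q_gt0 t ltac:(lia).
have N1 := NT_gt0; have N2 := psumQ_mono T t ltac:(lia).
have N3 := psumQ_mono t.+1 s ltac:(lia); rewrite NS in N3.
split; last by rewrite height_step; lia.
split; [by nia | by rewrite height_step; lia |].
move=> n1 k1 hn hy; rewrite height_step.
have ht : H t.+1 < 0 by apply: H_even; rewrite /= ?ot //; lia.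
(* For [j = 0] the competitors have [n1 < N t], and the bound at [t.-1] is strictly higher because
   [b t <= c t] and [H t.+1 < 0]. Otherwise the bound with one unit fewer suffices. *)
case: j jb hh hn => [|j] jb hh hn.
  have Et : t = t.-1.+1 by lia.
  have ot' : ~~ odd t.-1 by lia.
  have ts' : (t.-1 < s)%N by lia.
  have hn' : 1 <= n1 < N t.-1.+1 by rewrite -Et; lia.
  have := lower_odd_step _ _ _ ot' ts' hn' hy.
  have := b_le t ltac:(lia); have := HS t.-1; have := digit_sumS b H t.-1.
  have := H_odd t ot ltac:(lia).
  by rewrite -Et; nia.
have := lower_even_step _ _ _ _ ot ts (ltnW jb) hn hy; lia.
Qed.

(** A zero digit at [t] follows a maximal one, and then [N t - Q t] equals its value two indices
    earlier. The descent stops at a positive digit, at the latest at [T.+1] by [b_T1]. *)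
Lemma prev_gt0 t : ~~ odd t -> (T < t <= s)%N -> 1 <= N t - Q t.
Proof.
have [n] := ubnP t; elim: n t => // n IH [|[|t]] tn ot /andP[tT ts]; [by lia..|].
have N1 := NT_gt0; have N2 := psumQ_mono T t.+1 ltac:(lia).
have [q0 q1] := Q_gt0 t.+1 ltac:(lia).
have [b0|bp] := posnP (b t.+2); last by rewrite NS; nia.
have [_ /= b1] := b_zero t.+2 ltac:(lia) b0.
have tT1 : (T < t.+1)%N.
  rewrite ltn_neqAle; apply/andP; split; last by lia.
  by apply/eqP => ET; have := b_T1; rewrite ET b0; lia.
have := IH t ltac:(lia) ltac:(lia) ltac:(lia).
by rewrite !NS b0 b1 QS; lia.
Qed.

Lemma locate_above n t : (T <= t <= s)%N -> N T <= n < N t ->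
  (exists u j : nat, [/\ odd u, (T <= u < s)%N, (j < b u.+1)%N &
     N u + j%:Z * Q u.+1 <= n < N u + j.+1%:Z * Q u.+1]) \/
  (exists u : nat, [/\ ~~ odd u, (T < u < s)%N & N u <= n < N u.+1]).
Proof.
elim: t => [|t IH] ht hn; first by lia.
have [Et|tT] := eqVneq T t.+1; first by rewrite Et in hn; lia.
have [h|h] := ltrP n (N t); first by apply: IH; lia.
have [ot|ot] := boolP (odd t); last by right; exists t; split; lia.
have [_ q1] := Q_gt0 t ltac:(lia).
have [|j jb hj] := step_locate n (N t) (Q t.+1) (b t.+1) q1.
  by rewrite -NS; lia.
by left; exists t, j; split=> //; lia.
Qed.

Lemma record_high_point n k :
  record_point m d (N s) be n k -> height n k < d -> high_point n k.
Proof.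
move=> [hn hy rec] yd.
have nT : N T <= n.
  by rewrite leNgt; apply/negP => nT; have := below_NT n k; lia.
have ns : n < N s.
  rewrite lt_neqAle; apply/andP; split; last by lia.
  (* At [n = N s] every height is congruent to [be] modulo [d], so none lies strictly between [be]
     and [d]. *)
  apply/eqP => En; move: hy yd; rewrite En.
  have -> : height (N s) k = be + (K s - k) * d.
    by rewrite /be -height_psum /lattice_height /N /K; ring.
  move: (K s - k) => l; have [l0|l0] := lerP l 0; nia.
have [[t [j [ot ts jb hj]]]|[t [ot ts ht]]] := locate_above n s ltac:(lia) ltac:(lia).
  have ts' : (t < s)%N by lia.
  have hh := high_height _ _ ot ts' jb.
  have En : n = N t + j%:Z * Q t.+1.
    apply/eqP; rewrite eq_le; apply/andP; split; last by lia.
    rewrite leNgt; apply/negP => lt.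
    have := rec (N t + j%:Z * Q t.+1) (K t + j%:Z * P t.+1); rewrite height_step.
    have := psumQ_mono T t ltac:(lia); have := NT_gt0.
    have [_ q1] := Q_gt0 t ltac:(lia).
    have hn' : 1 <= n < N t + j.+1%:Z * Q t.+1 by lia.
    have := lower_even_step _ _ n k ot ts' jb hn'.
    by nia.
  exists t, j; split=> //; apply: (@height_inj n) => //.
  by rewrite En height_step; lia.
(* In the block of an odd-indexed digit, the earlier point [(N t - Q t, K t - P t)] is above [be]
   and no higher than the point at [n], which contradicts the strict record. *)
have N1 := prev_gt0 t ot ltac:(lia).
have := tail_bounds t ltac:(lia); rewrite (negbTE ot) => tb.
have := lower_odd_step t n k ot ltac:(lia) ltac:(lia).
have := rec (N t - Q t) (K t - P t).
have -> : height (N t - Q t) (K t - P t) = psum H t - H t.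
  by rewrite -height_psum /H /lattice_height /N /K; ring.
have := Q_pos t ltac:(lia); lia.
Qed.

Lemma height_low t (j : nat) :
  height (Q t + j%:Z * Q t.+1) (P t + j%:Z * P t.+1 - 1) = d + H t + j%:Z * H t.+1.
Proof. by rewrite /H /lattice_height; ring. Qed.

(** Compare with the lattice point [(1, 0)], whose height is [m]. *)
Lemma H_le t : odd t -> (t <= r)%N -> H t <= m.
Proof.
move=> ot tr; have := lower_homogeneous t 0 1 0 ot tr.
have := Q_gt0 t ltac:(lia).
have := Q_pos t ltac:(lia).
have := c_gt0 t.+1 ltac:(lia).
by rewrite /lattice_height; lia.
Qed.

Lemma low_point_record n k :
  low_point n k -> record_point m d (N s) be n k /\ d <= height n k.
Proof.
move=> [t [j [ot tT jc -> ->]]].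
have t2 : (t.+2 <= T)%N by lia.
have H0 := H_odd t ot ltac:(lia).
have H1 : H t.+1 < 0 by apply: H_even; rewrite /= ?ot //; lia.
have H2 := H_odd t.+2 ltac:(lia) ltac:(lia).
have y0 : 0 < H t + j%:Z * H t.+1 by rewrite HS in H2; nia.
have [q0 q1] := Q_gt0 t ltac:(lia).
have q0' := Q_pos t ltac:(lia).
have nT : 1 <= Q t + j%:Z * Q t.+1 < N T.
  have [-> _] := psum_T; have := b_T_gt0.
  have := Q_mono t.+2 T ltac:(lia); rewrite QS.
  have := Q_gt0 T.-2 ltac:(lia); have -> : T.-2.+1 = T.-1 by lia.
  have : Q t + j%:Z * Q t.+1 <= (c t.+1)%:Z * Q t.+1 + Q t by nia.
  by nia.
have Hm := H_le t ot ltac:(lia).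
(* The unshifted point has height below [m < d], so [below_NT] forbids it to exceed [be]; after the
   shift the height is at most [be + d]. *)
have ybe : H t + j%:Z * H t.+1 <= be.
  rewrite leNgt; apply/negP => lt.
  have := below_NT (Q t + j%:Z * Q t.+1) (P t + j%:Z * P t.+1) nT.
  have -> : height (Q t + j%:Z * Q t.+1) (P t + j%:Z * P t.+1)
    = H t + j%:Z * H t.+1 by rewrite /H /lattice_height; ring.
  by nia.
rewrite height_low; split; last by lia.
have := psumQ_mono T s ltac:(lia) => NTs.
split; [by lia | by rewrite height_low; lia |].
move=> n1 k1 hn hy; rewrite height_low.
have := below_NT n1 k1 ltac:(lia) hy.
case: j jc {y0 nT ybe} hn => [|j] jc hn; first by lia.
(* A competitor has height at least [d]; lowering it by [d] brings it under the homogeneous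
   bound. *)
have := lower_homogeneous t j n1 (k1 + 1) ot ltac:(lia) ltac:(lia) hn.
have -> : height n1 (k1 + 1) = height n1 k1 - d by rewrite /lattice_height; ring.
lia.
Qed.

Lemma locate_below n t : odd t -> (t <= T)%N -> 1 <= n < Q t ->
  exists u j : nat, [/\ odd u, (u < T)%N, (j < c u.+1)%N &
    Q u + j%:Z * Q u.+1 <= n < Q u + j.+1%:Z * Q u.+1].
Proof.
have [l] := ubnP t; elim: l t => // l IH [|[|t]] // tl ot tT hn.
  by rewrite Q1 in hn; lia.
have [h|h] := ltrP n (Q t); first by apply: (IH t); lia.
have [_ q1] := Q_gt0 t ltac:(lia).
have [|j jc hj] := step_locate n (Q t) (Q t.+1) (c t.+1) q1.
  by rewrite QS in hn; lia.
by exists t, j; split=> //; lia.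
Qed.

(** A convergent is the last intermediate point of the preceding odd index, with [j] maximal;
    [low_point] counts it there, not with [j = 0]. *)
Lemma low_point_Q n k t : odd t -> (1 < t <= T)%N -> n = Q t ->
  k = P t - 1 -> low_point n k.
Proof.
case: t => [|[|t]] // ot tT -> ->; exists t, (c t.+1).
by have := c_gt0 t.+1 ltac:(lia); rewrite QS PS; split; try lia; ring.
Qed.

Lemma one_record_point : m < be ->
  record_point m d (N s) be 1 (-1) /\ d <= height 1 (-1).
Proof.
move=> mb; split; last by rewrite /lattice_height; lia.
by split; [lia | rewrite /lattice_height; lia | move=> n1 k1; lia].
Qed.

Lemma record_low_point n k : record_point m d (N s) be n k -> d <= height n k ->
  [/\ m < be, n = 1 & k = -1] \/ low_point n k.
Proof.
move=> [hn hy rec] yd.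
have nT : n < N T.
  rewrite ltNge; apply/negP => nT.
  have [Ts|Ts] := eqVneq T s.
    rewrite Ts in nT; have En : n = N s by lia.
    have Ey : height n k = be + (K s - k) * d.
      by rewrite En /be -height_psum /lattice_height /N /K; ring.
    move: hy; rewrite Ey; move: (K s - k) Ey => l Ey hy.
    have l1 : l = 1.
      by have [l0|l0] := lerP l 0; [|have [l2|l2] := lerP 2 l]; nia.
    rewrite l1 mul1r in Ey.
    (* The point of abscissa 1 with height in the interval from [be] to [be + d] is an earlier
       competitor that is not higher. *)
    have := rec 1 (if be < m then 0 else -1) ltac:(lia).
    by rewrite Ey; case: ifP => hb; rewrite /lattice_height; lia.
  have Ts' : (T < s)%N by lia.
  (* The high point [(N T, K T)] has height strictly between [be] and [d]: a later record would be
     lower still, and at [n = N T] itself another height in the window is impossible. *)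
  have := high_height _ _ T_odd Ts' (b_T1 Ts'); have := rec (N T) (K T).
  have ET : height (N T) (K T) = psum H T by exact: height_psum.
  have := NT_gt0; rewrite ET.
  have [En|ne] := eqVneq n (N T); last by lia.
  have : height n k = psum H T + (K T - k) * d.
    by rewrite -ET En /lattice_height; ring.
  by have [->| |] := multiple_cases (K T - k); lia.
have [n1|n1] := eqVneq n 1.
  left; move: hy yd; rewrite n1 /lattice_height => hy yd.
  have Ek : k = -1 by nia.
  by rewrite Ek in hy *; split=> //; move: m_neq; lia.
right.
have Ek : height n (k + 1) = height n k - d by rewrite /lattice_height; ring.
have [nQ|nQ] := ltrP n (Q T).
  have [t [j [ot tT jc hj]]] := locate_below n T T_odd (leqnn T) ltac:(lia).
  have t2 : (t.+2 <= T)%N by lia.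
  have H1 : H t.+1 < 0 by apply: H_even; rewrite /= ?ot //; lia.
  have H2 := H_odd t.+2 ltac:(lia) ltac:(lia).
  have y0 : 0 < H t + j%:Z * H t.+1 by rewrite HS in H2; nia.
  have [q0 q1] := Q_gt0 t ltac:(lia).
  have q0' := Q_pos t ltac:(lia).
  have lb := lower_homogeneous t j n (k + 1) ot ltac:(lia) jc ltac:(lia) ltac:(lia).
  have En : n = Q t + j%:Z * Q t.+1.
    apply/eqP; rewrite eq_le; apply/andP; split; last by lia.
    rewrite leNgt; apply/negP => lt.
    have := rec (Q t + j%:Z * Q t.+1) (P t + j%:Z * P t.+1 - 1).
    by rewrite height_low; nia.
  have Hm := H_le t ot ltac:(lia).
  have Ekk : k = P t + j%:Z * P t.+1 - 1.
    have : height n k = d + H t + j%:Z * H t.+1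
                        + (P t + j%:Z * P t.+1 - 1 - k) * d.
      by rewrite -height_low -En /lattice_height; ring.
    move=> E; suff : P t + j%:Z * P t.+1 - 1 - k = 0 by lia.
    have : H t + j%:Z * H t.+1 < d by nia.
    by have [| |] := multiple_cases (P t + j%:Z * P t.+1 - 1 - k); lia.
  case: (posnP j) => j0; last by exists t, j; split=> //; lia.
  rewrite j0 !mul0r !addr0 in En Ekk.
  apply: (low_point_Q _ _ t) => //.
  have [t1|] := eqVneq t 1%N; last by lia.
  by rewrite t1 Q1 in En; lia.
(* Here [Q T <= n < N T < Q T + Q T.+1], and the homogeneous bound with [j = 0] leaves only
   [n = Q T]. *)
have H0 := H_odd T T_odd ltac:(lia).
have lb := lower_homogeneous T 0 n (k + 1) T_odd ltac:(lia)
  (c_gt0 T.+1 ltac:(lia)).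
have NT := psumQ_lt T T_le.
have q0' := Q_pos T ltac:(lia).
have ET : height (Q T) (P T - 1) = d + H T by rewrite /H /lattice_height; ring.
have En : n = Q T.
  by have := rec (Q T) (P T - 1); rewrite ET; lia.
have Hm := H_le T T_odd ltac:(lia).
apply: (low_point_Q _ _ T) => //.
  have [T1|] := eqVneq T 1%N; last by lia.
  by rewrite T1 Q1 in En; lia.
have : height n k = d + H T + (P T - 1 - k) * d.
  by rewrite -ET -En /lattice_height; ring.
move=> E; suff : P T - 1 - k = 0 by lia.
by have [| |] := multiple_cases (P T - 1 - k); lia.
Qed.

Lemma record_classification :
  [/\ forall n k, record_point m d (N s) be n k /\ d <= height n k <->
        [/\ m < be, n = 1 & k = -1] \/ low_point n k,
      forall n k, record_point m d (N s) be n k /\ height n k < d <->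
        high_point n k &
      forall n k, low_point n k -> 1 < n].
Proof.
split=> n k.
- split=> [[h1 h2]|[[mb -> ->]|h]]; first exact: record_low_point.
    exact: one_record_point.
  exact: low_point_record.
- by split=> [[h1 h2]|h]; [exact: record_high_point | exact: high_point_record].
move=> [t [j [ot tT jc -> _]]].
have := Q_pos t ltac:(lia); have := Q_pos t.+1 ltac:(lia); nia.
Qed.

End InhomogeneousRecords.

(** * Pseudo-Frobenius numbers as records *)

Section PseudoFrobenius.

Variables (a b d m : nat) (tau : int).
Hypotheses (hab : coprime a b) (a_gt1 : (1 < a)%N) (a_lt : (a < d)%N).
Hypothesis b_gt0 : (0 < b)%N.
Hypothesis tauE : tau * d%:Z = a%:Z * m%:Z + b%:Z.
Let S := quot_semigroup (semigroup2 a b) d.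
Local Notation height := (lattice_height m%:Z d%:Z).

Lemma inZ_quotE x : inZ S x <-> exists u v : int,
  [/\ 0 <= u, 0 <= v & d%:Z * x = u * a%:Z + v * b%:Z].
Proof.
split.
  by move=> [n [u [v E]] <-]; exists u%:Z, v%:Z; split=> //; lia.
move=> [u [v [u0 v0 E]]]; have x0 : 0 <= x by nia.
exists `|x|%N; last by lia.
exists `|u|%N, `|v|%N; apply/eqP; rewrite -(eqr_nat int).
rewrite natrD !natrM !natz !gez0_abs //; by apply/eqP.
Qed.

(** Multiplication by [d] gives [(n * m - k * d) * a + n * b]. Every other representation has [v]
    congruent to [n] modulo [a], and [v = n] gives the largest coefficient of [a]. *)
Lemma inZ_coord (n k : int) : 0 <= n < a%:Z ->
  inZ S (tau * n - a%:Z * k) <-> k * d%:Z <= n * m%:Z.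
Proof.
move=> hn.
have Ed : d%:Z * (tau * n - a%:Z * k) = (n * m%:Z - k * d%:Z) * a%:Z + n * b%:Z.
  transitivity (tau * d%:Z * n - a%:Z * k * d%:Z); first by ring.
  by rewrite tauE; ring.
rewrite inZ_quotE Ed; split; last first.
  by move=> h; exists (n * m%:Z - k * d%:Z), n; split=> //; lia.
move=> [u [v [u0 v0 E]]].
have dv : (a%:Z %| v - n)%Z.
  rewrite -(@Gauss_dvdzl _ _ b%:Z) //.
  apply/dvdzP; exists (n * m%:Z - k * d%:Z - u).
  by rewrite mulrBl; lia.
have /dvdzP[l El] := dv.
have Ev : v = l * a%:Z + n by lia.
have l0 : 0 <= l by nia.
have : a%:Z * (n * m%:Z - k * d%:Z - u - l * b%:Z) = 0 by rewrite Ev in E; lia.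
move/eqP; rewrite mulf_eq0 => /orP[/eqP|/eqP]; first by lia.
by nia.
Qed.

Lemma coprime_tau : coprimez tau a%:Z.
Proof.
suff : (gcdz tau a%:Z %| 1)%Z.
  by rewrite dvdz1 /coprimez /gcdz /= => /eqP ->.
have -> : Posz 1 = gcdz a%:Z b%:Z by move: hab; rewrite /coprime /gcdz /= => /eqP ->.
rewrite dvdz_gcd dvdz_gcdr /=.
have -> : b%:Z = tau * d%:Z - a%:Z * m%:Z by rewrite tauE; ring.
by rewrite rpredB // dvdz_mulr ?dvdz_gcdl ?dvdz_gcdr.
Qed.

Lemma coord_ex (x : int) : exists n k : int,
  0 <= n < a%:Z /\ x = tau * n - a%:Z * k.
Proof.
have a0 : a%:Z != 0 by lia.
have /coprimezP[[u v] /= E] := coprime_tau.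
exists ((x * u) %% a%:Z)%Z, (- x * v - tau * ((x * u) %/ a%:Z)%Z).
split; first by rewrite modz_ge0 //= ltz_pmod //; lia.
have := divz_eq (x * u) a%:Z; set q := (_ %/ _)%Z; set w := (_ %% _)%Z => Ew.
have -> : w = x * u - q * a%:Z by rewrite Ew; ring.
by rewrite -[LHS]mulr1 -E; ring.
Qed.

(** Elements with [n' = 0] are multiples of [a] and only bound [k] from above. When [n + n'] reaches
    [a], reducing it shifts [k] by [tau], and [tau * d = a * m + b] turns this carry into the term
    [b]. *)
Lemma PF_coord (n k : int) : 0 <= n < a%:Z ->
  PF S (tau * n - a%:Z * k) <->
  n * m%:Z < k * d%:Z <= n * m%:Z + d%:Z /\
  forall n' k' : int, 1 <= n' < a%:Z -> k' * d%:Z <= n' * m%:Z ->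
    (k + k') * d%:Z <= (n + n') * m%:Z + (if n + n' < a%:Z then 0 else b%:Z).
Proof.
move=> hn.
have sum n' k' : 0 <= n' < a%:Z ->
  inZ S (tau * n - a%:Z * k + (tau * n' - a%:Z * k')) <->
  (k + k') * d%:Z <= (n + n') * m%:Z + (if n + n' < a%:Z then 0 else b%:Z).
  move=> hn'; case: ifP => hnn.
    have -> : tau * n - a%:Z * k + (tau * n' - a%:Z * k')
      = tau * (n + n') - a%:Z * (k + k') by ring.
    by rewrite addr0; apply: inZ_coord; lia.
  have -> : tau * n - a%:Z * k + (tau * n' - a%:Z * k')
      = tau * (n + n' - a%:Z) - a%:Z * (k + k' - tau) by ring.
  rewrite inZ_coord; last by lia.
  by rewrite !mulrBl tauE; split; lia.
split.
  move=> [nS hS].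
  have h1 : n * m%:Z < k * d%:Z by rewrite ltNge; apply/negP => /(inZ_coord n k hn).
  have aS : S a by exists d, 0%N; lia.
  have := hS a aS ltac:(lia).
  have -> : tau * n - a%:Z * k + a%:Z = tau * n - a%:Z * (k - 1) by ring.
  move=> /(inZ_coord n (k - 1) hn) h2; split; first by lia.
  move=> n' k' hn' hk'.
  have hn0 : 0 <= n' < a%:Z by lia.
  have /(inZ_coord n' k' hn0) [s Ss Es] := hk'.
  apply/(sum n' k' hn0); rewrite -Es; apply: hS => // s0.
  (* If [s] were 0, then [tau * d = a * m + b] and [k' * d <= n' * m] would give [n' * b <= 0]. *)
  have : tau * d%:Z * n' - a%:Z * (k' * d%:Z) = 0.
    rewrite -[RHS](mulr0 d%:Z); have -> : 0 = s%:Z by lia.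
    by rewrite Es; ring.
  by rewrite tauE; nia.
move=> [h1 hS]; split; first by move/(inZ_coord n k hn); lia.
move=> s Ss s0; have [n' [k' [hn' Es]]] := coord_ex s%:Z.
rewrite Es; apply/(sum n' k' hn').
have hk' : k' * d%:Z <= n' * m%:Z by apply/(inZ_coord n' k' hn'); exists s.
have [n0|n0] := eqVneq n' 0; last by apply: hS => //; lia.
rewrite n0 addr0; have -> : n < a%:Z by lia.
have : k' < 0 by rewrite n0 mulr0 in Es; nia.
nia.
Qed.

Variable kap : int.
Let be : int := a%:Z * m%:Z - kap * d%:Z.

(** Reflection of the coordinates in [(a, kap)]: a height [h] becomes [be - h], so lying outside [S]
    reads [h > be]. *)
Definition PF_value (n k : int) : int := tau * (a%:Z - n) - a%:Z * (kap - k).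

Lemma PF_value_inj (n k n' k' : int) : 1 <= n <= a%:Z -> 1 <= n' <= a%:Z ->
  PF_value n k = PF_value n' k' -> n = n' /\ k = k'.
Proof.
move=> hn hn' E.
have dv : (a%:Z %| n - n')%Z.
  rewrite -(@Gauss_dvdzr _ tau) 1?coprimez_sym ?coprime_tau //.
  by apply/dvdzP; exists (k - k'); move: E; rewrite /PF_value; lia.
have /dvdzP[l El] := dv.
have l0 : l = 0 by nia.
have Enn : n = n' by rewrite l0 in El; lia.
split=> //; move: E; rewrite /PF_value Enn => E.
have : a%:Z * (k - k') = 0 by lia.
by move/eqP; rewrite mulf_eq0 => /orP[/eqP|/eqP]; lia.
Qed.

(** With [(n1, k1) = (n - n', k - k')], the sums without carry are the contrapositive of the record
    condition; those with carry remain as the extra condition. *)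
Lemma PF_value_record (n k : int) : 1 <= n <= a%:Z ->
  PF S (PF_value n k) <->
  record_point m%:Z d%:Z a%:Z be n k /\
  (forall n' k' : int, n <= n' < a%:Z -> k' * d%:Z <= n' * m%:Z ->
     (kap - k + k') * d%:Z <= (a%:Z - n + n') * m%:Z + b%:Z).
Proof.
move=> hn; rewrite /PF_value PF_coord; last by lia.
rewrite /record_point /record_at /lattice_height /be; split.
  move=> [h1 h2]; split; first split=> //; first by lia.
    move=> n1 k1 hn1 hy.
    have := h2 (n - n1) (k - k1) ltac:(lia).
    have -> : a%:Z - n + (n - n1) < a%:Z by lia.
    lia.
  move=> n' k' hn' hk'; have := h2 n' k' ltac:(lia) hk'.
  by have -> : a%:Z - n + n' < a%:Z = false by lia.
move=> [[_ h1 h2] h3]; split; first by rewrite !mulrBl; lia.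
move=> n' k' hn' hk'; case: ifP => hnn; last by apply: h3; lia.
have := h2 (n - n') (k - k') ltac:(lia).
lia.
Qed.

Lemma PF_value_ex x : exists n k : int, 1 <= n <= a%:Z /\ x = PF_value n k.
Proof.
have [n [k [hn ->]]] := coord_ex x.
by exists (a%:Z - n), (kap - k); split; [lia | rewrite /PF_value; ring].
Qed.

(** The carry condition is automatic, as the height is at most [be + d < be + b]. *)
Lemma PF_large_b : (d < b)%N ->
  PF S = [set x | exists n k, record_point m%:Z d%:Z a%:Z be n k /\
                              x = PF_value n k].
Proof.
move=> db; apply/seteqP; split=> x /=.
  have [n [k [hn ->]]] := PF_value_ex x.
  by move/(PF_value_record n k hn) => [h _]; exists n, k.
move=> [n [k [h ->]]]; have [hn hy _] := h.
apply/(PF_value_record n k hn); split=> // n' k' hn' hk'.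
by move: hy; rewrite /lattice_height /be; lia.
Qed.

(** Each nonzero [s] in [S] yields [s - w] in [S], so by descent [w] divides all of [S], in
    particular [a] and [b]. Hence [w = 1], and 1 in [S] means that [d] is in the semigroup. *)
Lemma PF_negative (w : nat) : S w -> (0 < w)%N -> PF S (- w%:Z) ->
  semigroup2 a b d.
Proof.
move=> Sw w0 [_ hS].
have dvd_w s : S s -> (w %| s)%N.
  have [n] := ubnP s; elim: n s => // n IH s sn Ss.
  have [->|s0] := eqVneq s 0%N; first exact: dvdn0.
  have [s' Ss' Es'] := hS s Ss ltac:(lia).
  have E : s = (s' + w)%N by lia.
  by rewrite E dvdn_add ?dvdnn // IH //; lia.
have wa : (w %| a)%N by apply: dvd_w; exists d, 0%N; lia.
have wb : (w %| b)%N by apply: dvd_w; exists 0%N, d; lia.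
have : (w %| 1)%N by rewrite -(eqP hab) dvdn_gcd wa.
by rewrite dvdn1 => /eqP w1; move: Sw; rewrite w1 /S /quot_semigroup /= muln1.
Qed.

(** Here [kap = tau - 1], so a record of height at least [d] has value [- w] with [w] positive in
    [S]. Below [d], the carry condition follows from [be + b = d]. *)
Lemma PF_small_b : (b < d)%N -> be = d%:Z - b%:Z -> ~ semigroup2 a b d ->
  PF S = [set x | exists n k, [/\ record_point m%:Z d%:Z a%:Z be n k,
                   height n k < d%:Z & x = PF_value n k]].
Proof.
move=> bd Ebe hd; apply/seteqP; split=> x /=.
  have [n [k [hn ->]]] := PF_value_ex x => hPF.
  have [h _] := (PF_value_record n k hn).1 hPF.
  exists n, k; split=> //; rewrite ltNge; apply/negP => hy; apply: hd.
  pose w := tau * n - a%:Z * (k + 1).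
  have Ed : d%:Z * w = (n * m%:Z - (k + 1) * d%:Z) * a%:Z + n * b%:Z.
    transitivity (tau * d%:Z * n - a%:Z * (k + 1) * d%:Z); first by rewrite /w; ring.
    by rewrite tauE; ring.
  have y0 : 0 <= n * m%:Z - (k + 1) * d%:Z by move: hy; rewrite /lattice_height; lia.
  have w0 : 0 < w by nia.
  have [s Ss Es] : inZ S w.
    by apply/inZ_quotE; exists (n * m%:Z - (k + 1) * d%:Z), n; split=> //; lia.
  apply: (PF_negative s Ss); first by lia.
  suff -> : - s%:Z = PF_value n k by [].
  rewrite Es /PF_value /w; suff -> : kap = tau - 1 by ring.
  have : (tau - 1 - kap) * d%:Z = 0.
    by rewrite !mulrBl tauE; move: Ebe; rewrite /be; lia.
  by move/eqP; rewrite mulf_eq0 => /orP[/eqP|/eqP]; lia.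
move=> [n [k [h hy ->]]]; have [hn _ _] := h.
apply/(PF_value_record n k hn); split=> // n' k' hn' hk'.
by move: hy Ebe; rewrite /lattice_height /be; lia.
Qed.

End PseudoFrobenius.

(** * Continued fractions and numeration *)

Definition qconv (A : seq nat) (i : nat) : int := (convq_shift A i.+1)%:Z.
Definition pconv (A : seq nat) (i : nat) : int := (convp_shift A i.+1)%:Z.

Lemma qconvS A i : qconv A i.+2 = (pquot A i.+1)%:Z * qconv A i.+1 + qconv A i.
Proof. by rewrite /qconv -PoszM -PoszD. Qed.

Lemma pconvS A i : pconv A i.+2 = (pquot A i.+1)%:Z * pconv A i.+1 + pconv A i.
Proof. by rewrite /pconv -PoszM -PoszD. Qed.

Lemma pquot_gt0 A i : all (fun x => 0 < x)%N A ->
  (0 < i <= (size A).+1)%N -> (0 < pquot A i)%N.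
Proof.
move=> A0 hi; have : all (fun x => 0 < x)%N (rcons A 1%N) by rewrite all_rcons.
move/(all_nthP 0%N) => /(_ i.-1); rewrite size_rcons /pquot.
case: i hi => // i hi /= h; apply: h; lia.
Qed.

Lemma cf_val_drop A i : (i <= size A)%N ->
  cf_val (drop i (0%N :: rcons A 1%N)) =
  (pquot A i)%:R + (cf_val (drop i.+1 (0%N :: rcons A 1%N)))^-1.
Proof.
move=> hi; rewrite /pquot; set u := _ :: _.
have su : size u = (size A).+2 by rewrite /u /= size_rcons.
rewrite (drop_nth 0%N) ?su; last by lia.
case E : (drop i.+1 u) => //.
by have := size_drop i.+1 u; rewrite E su /=; lia.
Qed.

Lemma cf_val_gt0 A i : all (fun x => 0 < x)%N A -> (0 < i <= (size A).+1)%N ->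
  0 < cf_val (drop i (0%N :: rcons A 1%N)).
Proof.
move=> A0 /andP[i0 ile]; rewrite -(subKn ile).
have : ((size A).+1 - i <= size A)%N by lia.
elim: (_ - i)%N => [|l IH] hl.
  by rewrite subn0 /= -{1}cats1 drop_size_cat.
rewrite cf_val_drop; last by lia.
have -> : ((size A).+1 - l.+1).+1 = ((size A).+1 - l)%N by lia.
by rewrite ltr_wpDr ?invr_ge0 ?(ltW (IH _)) ?ltr0n ?pquot_gt0 //; lia.
Qed.

(* With xi_i = [a_i, ..., a_r, 1], the scaled differences H_i = q_(i-1) m - p_(i-1) d
   satisfy H_i = - xi_(i+1) H_(i+1), so they alternate in sign. *)
Lemma conv_height_step A (m d : nat) i :
  (0 < m)%N -> (0 < d)%N -> is_cf (m%:R / d%:R) A -> (i <= size A)%N ->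
  let H i := lattice_height m%:Z d%:Z (qconv A i) (pconv A i) in
  (H i)%:~R = - cf_val (drop i.+1 (0%N :: rcons A 1%N)) * (H i.+1)%:~R :> rat.
Proof.
move=> m0 d0 [A0 Ea] hi H; elim: i hi => [|i IH] hi.
  have := cf_val_drop A 0 (leq0n _); rewrite drop0 -Ea /pquot /= add0r drop0 => E.
  have -> : H 1%N = m%:Z.
    by rewrite /H /qconv /pconv /lattice_height /= /pquot /=; lia.
  have -> : H 0%N = - d%:Z by rewrite /H /qconv /pconv /lattice_height /=; lia.
  rewrite -[cf_val _]invrK -E invf_div rmorphN /= mulNr.
  by rewrite -!pmulrn divfK // pnatr_eq0; lia.
have xi0 := cf_val_gt0 A i.+2 A0 ltac:(lia).
have E2 : H i.+2 = (pquot A i.+1)%:Z * H i.+1 + H i.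
  by rewrite /H /lattice_height qconvS pconvS; ring.
clearbody H; rewrite E2 intrD intrM IH; last by lia.
rewrite (cf_val_drop A i.+1) //; move: xi0; set xi := cf_val _ => xi0.
rewrite -pmulrn; field; lra.
Qed.

Lemma conv_height_sign A (m d i : nat) :
  (0 < m)%N -> (0 < d)%N -> is_cf (m%:R / d%:R) A -> (i <= (size A).+1)%N ->
  let H := lattice_height m%:Z d%:Z (qconv A i) (pconv A i) in
  if odd i then 0 < H else H < 0.
Proof.
move=> m0 d0 hA; elim: i => [|i IH] hi /=.
  by rewrite /qconv /pconv /lattice_height /=; lia.
have := conv_height_step A m d i m0 d0 hA ltac:(lia) => /=.
have := cf_val_gt0 A i.+1 hA.1 ltac:(lia).
have /= := IH ltac:(lia).
set xi := cf_val _; set h := lattice_height _ _ _ _; set h' := lattice_height _ _ _ _.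
case: (odd i) => /=; rewrite -?(ltr0z rat) -?(ltrz0 rat) => hh xi0 E;
  by rewrite E in hh; nra.
Qed.

Lemma floor_divn (x d : nat) : (0 < d)%N ->
  Num.floor (x%:R / d%:R : rat) = (x %/ d)%:Z.
Proof.
move=> d0; apply: floor_def; rewrite -PoszD -!pmulrn.
rewrite ler_pdivlMr ?ltr0n // ltr_pdivrMr ?ltr0n // -!natrM ler_nat ltr_nat.
by rewrite addn1 leq_divM ltn_ceil.
Qed.

Lemma frac_divn (x d : nat) : (0 < d)%N ->
  frac (x%:R / d%:R) = (x %% d)%:R / d%:R.
Proof.
move=> d0; have dn : d%:R != 0 :> rat by rewrite pnatr_eq0; lia.
rewrite /frac floor_divn // -pmulrn {1}(divn_eq x d) natrD natrM.
by field.
Qed.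

(** The signs of the expansion cancel those inside [delta], leaving [q_j * m - p_j * d] after
    scaling by [d]. *)
Lemma numeration_psum A D (m d : nat) (beta : rat) s : (0 < d)%N ->
  is_numeration A (m%:R / d%:R) beta D -> last_nonzero D s ->
  beta * d%:R = (digit_sum (digit D)
    (fun i => lattice_height m%:Z d%:Z (qconv A i) (pconv A i)) s)%:~R.
Proof.
move=> d0 [[sD _] ->] [ds dlt]; rewrite /digit_sum.
have sle : (s <= size A)%N.
  rewrite leqNgt; apply/negP => slt; move: ds.
  by rewrite /digit nth_default //= sD.
rewrite rmorph_sum /= mulr_suml (big_cat_nat (n := s.+1)) //=.
rewrite [X in _ + X]big_nat_cond [X in _ + X]big1 ?addr0; last first.
  by move=> i /andP[/andP[si _] _]; rewrite dlt // mulr0 !mul0r.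
rewrite big_nat_cond [RHS]big_nat_cond; apply: eq_bigr => i.
case: i => [|i] /andP[/andP[i0 _] _] //.
have dn : d%:R != 0 :> rat by rewrite pnatr_eq0; lia.
rewrite succnK /delta /convq /convp /lattice_height /qconv /pconv.
rewrite intrM intrB !intrM -!pmulrn.
transitivity (((-1) ^+ i * (-1) ^+ i) * (digit D i.+1)%:R *
  ((convq_shift A i.+2)%:R * m%:R - (convp_shift A i.+2)%:R * d%:R) : rat).
  by field.
by rewrite -expr2 sqrr_sign mul1r.
Qed.

(** * The index [k0], duplicate-free lists and residues *)

Lemma bigminn_mem i (B : seq nat) : \big[minn/i]_(j <- B) j \in i :: B /\
  forall j, j \in i :: B -> (\big[minn/i]_(j <- B) j <= j)%N.
Proof.
elim: B => [|x B [IH1 IH2]].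
  by rewrite big_nil inE; split=> // j; rewrite inE => /eqP ->.
rewrite big_cons; split.
  rewrite /minn; case: ifP => _; rewrite !inE ?eqxx ?orbT //.
  by move: IH1; rewrite inE => /orP[->|->]; rewrite ?orbT.
move=> j; rewrite !inE => /or3P[/eqP ->|/eqP ->|jB]; rewrite geq_min ?leqnn //.
  by rewrite IH2 ?orbT // inE eqxx.
by rewrite IH2 ?orbT // inE jB orbT.
Qed.

Lemma mem_Bset D s i : (i \in Bset D s) =
  (0 < i <= s %/ 2)%N && (digit D (2 * i) != 0%N).
Proof. by rewrite mem_filter mem_iota andbC; congr (_ && _); lia. Qed.

(** These are the facts behind [T = 2 * k0 - 1]. If [Bset] is empty, [s] is odd because its digit is
    nonzero, and [2 * k0 = s + 1]. *)
Lemma k0P D s : last_nonzero D s ->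
  [/\ (0 < k0 D s)%N, (2 * k0 D s <= s.+1)%N,
      forall i, (0 < i < k0 D s)%N -> digit D (2 * i) = 0%N &
      (2 * k0 D s <= s)%N -> (0 < digit D (2 * k0 D s))%N].
Proof.
move=> [ds _]; rewrite /k0; have := mem_Bset D s; case: (Bset D s) => [|i B] hB.
  have os : odd s.
    apply: contraT => os; have := hB (s %/ 2)%N; rewrite in_nil.
    have -> : (2 * (s %/ 2) = s)%N by lia.
    have s0 : (0 < s)%N by case: (s) ds.
    by rewrite -lt0n ds andbT; lia.
  split; [lia | lia | | lia].
  move=> i hi; have := hB i; rewrite in_nil.
  by have [//|_] := eqVneq (digit D (2 * i)) 0%N; lia.
have [] := bigminn_mem i B; set x := \big[_/_]_(_ <- _) _ => xB xmin.
move: (hB x); rewrite xB => /esym/andP[x1 x2].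
split; [lia | lia | | lia].
move=> j hj; apply/eqP; apply: contraT => dj.
have : j \in i :: B by rewrite hB dj andbT; lia.
by move/xmin; lia.
Qed.

Lemma card_uniq_seq (T : choiceType) (u : seq T) : uniq u ->
  ([set x | x \in u] #= `I_(size u))%card.
Proof.
elim: u => [|x u IH] /=.
  by move=> _; rewrite (_ : [set x | x \in [::]] = set0) ?II0 //; apply/seteqP; split.
move=> /andP[xu uu]; apply/eq_cardSP; exists x; first by rewrite /= inE eqxx.
rewrite (_ : _ `\ x = [set y | y \in u]) ?IH //.
apply/seteqP; split=> y /=; rewrite inE; first by case=> /orP[/eqP ->|//].
by move=> yu; rewrite yu orbT; split=> // yx; move: xu; rewrite -yx yu.
Qed.

Lemma uniq_pairs (f : nat -> nat -> int) (u : seq nat) (t : nat -> seq nat) :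
  uniq u -> (forall k, uniq (t k)) ->
  (forall k j k' j', k \in u -> j \in t k -> k' \in u -> j' \in t k' ->
     f k j = f k' j' -> k = k' /\ j = j') ->
  uniq [seq f k j | k <- u, j <- t k].
Proof.
move=> + ut; elim: u => //= x u IH /andP[xu uu] inj.
rewrite cat_uniq; apply/and3P; split.
- rewrite map_inj_in_uniq // => j j' hj hj' E.
  by have [] := inj x j x j' (mem_head _ _) hj (mem_head _ _) hj' E.
- apply/hasPn => y /allpairsPdep[k [j [hk hj ->]]].
  apply/negP => /mapP[j' hj' E].
  have hk' : k \in x :: u by rewrite inE hk orbT.
  have [E' _] := inj k j x j' hk' hj (mem_head _ _) hj' E.
  by rewrite -E' hk in xu.
apply: IH => // k j k' j' hk hj hk' hj'.
by apply: inj => //; rewrite inE ?hk ?hk' orbT.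
Qed.

Lemma modn_compl (x y d : nat) : (0 < y %% d)%N -> ((x + y) %% d = 0)%N ->
  (x %% d + y %% d = d)%N.
Proof.
move=> y0 E; have d0 : (0 < d)%N by case: d y0 E => // y0 E; lia.
have : ((x %% d + y %% d) %% d = 0)%N by rewrite modnDm.
have := ltn_pmod x d0; have := ltn_pmod y d0.
move: (x %% d)%N (y %% d)%N y0 => u v v0 vd ud.
have [lt|ge] := ltnP (u + v) d; first by rewrite modn_small; lia.
have -> : (u + v = d + (u + v - d))%N by lia.
by rewrite modnDl modn_small; lia.
Qed.

(** * The given data as an instance of the record problem *)

Section Assembly.

Variables (a b d m : nat) (alpha beta : rat) (A D : seq nat) (s : nat).
Hypotheses (hab : coprime a b) (hbd : coprime b d).
Hypothesis hmin : (1 < minn a b < d)%N.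
Hypothesis hm : (1 <= m <= d - 1)%N.
Hypothesis hmod : (a * m + b)%N = 0%N %[mod d].
Hypothesis halpha : alpha = m%:R / d%:R.
Hypothesis hA : is_cf alpha A.
Hypothesis hbeta : beta = frac (a%:R * alpha).
Hypothesis hD : is_numeration A alpha beta D.
Hypothesis hs : last_nonzero D s.

Let d_gt1 : (1 < d)%N.
Proof. by lia. Qed.

Lemma b_mod_gt0 : (0 < b %% d)%N.
Proof.
rewrite lt0n; apply/negP => /eqP E.
have /gcdn_idPr Eg : (d %| b)%N by rewrite /dvdn E.
by move: hbd; rewrite /coprime Eg; lia.
Qed.

Lemma beta_modE : beta = (a * m %% d)%:R / d%:R.
Proof.
by rewrite hbeta halpha mulrA -natrM frac_divn //; lia.
Qed.

Lemma mod_sum : (a * m %% d + b %% d = d)%N.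
Proof. by apply: modn_compl; [exact: b_mod_gt0 | rewrite hmod mod0n]. Qed.

Lemma beta_compl : beta = 1 - frac (b%:R / d%:R).
Proof.
have dn : d%:R != 0 :> rat by rewrite pnatr_eq0; lia.
rewrite beta_modE frac_divn; last by lia.
have : (a * m %% d)%:R + (b %% d)%:R = d%:R :> rat by rewrite -natrD mod_sum.
by move/(canRL (addrK _)) => ->; field.
Qed.

Hypothesis a_lt : (a < d)%N.

Let Q := qconv A.
Let P := pconv A.
Let N := digit_sum (digit D) Q.
Let K := digit_sum (digit D) P.
Let H i := lattice_height m%:Z d%:Z (Q i) (P i).
Let T := (2 * k0 D s).-1.
Let tauz : int := (tau a b d m)%:Z.
Let kap : int := (a * m %/ d)%:Z.
Let be : int := a%:Z * m%:Z - kap * d%:Z.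
Let X := PF_value a tauz kap.

Let hA' : is_cf (m%:R / d%:R) A.
Proof. by rewrite -halpha. Qed.

Let hD' : is_numeration A (m%:R / d%:R) beta D.
Proof. by rewrite -halpha. Qed.

Lemma be_modE : be = (a * m %% d)%:Z.
Proof. by rewrite /be /kap -!PoszM {1}(divn_eq (a * m) d); lia. Qed.

Lemma be_psum : be = digit_sum (digit D) H s.
Proof.
apply: (@intr_inj rat); rewrite -(numeration_psum A D m d beta s) //; last by lia.
rewrite be_modE beta_modE divfK ?pnatr_eq0 -?pmulrn //; lia.
Qed.

Lemma s_le_size : (s <= size A)%N.
Proof.
have [[sD _] _] := hD; have [ds _] := hs; rewrite leqNgt; apply/negP => slt.
by move: ds; rewrite /digit nth_default //= sD.
Qed.

Lemma digit_le i : (0 < i <= s)%N -> (digit D i <= pquot A i)%N.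
Proof.
move=> hi; have [[_ E] _] := hD; have := s_le_size.
by move=> sA; have [] := E i ltac:(lia).
Qed.

Lemma digit_zero i : (0 < i <= s)%N -> digit D i = 0%N ->
  (1 < i)%N /\ digit D i.-1 = pquot A i.-1.
Proof.
move=> hi di; have [[_ E] _] := hD; have sA := s_le_size.
have [_ /(_ di) [h|//]] := E i ltac:(lia).
by have [ds _] := hs; have := h s ltac:(lia); lia.
Qed.

Let QS i : Q i.+2 = (pquot A i.+1)%:Z * Q i.+1 + Q i := qconvS A i.
Let PS i : P i.+2 = (pquot A i.+1)%:Z * P i.+1 + P i := pconvS A i.

Let c_gt0 i : (0 < i <= (size A).+1)%N -> (0 < pquot A i)%N.
Proof. by apply: pquot_gt0; case: hA. Qed.

Let H_odd i : odd i -> (i <= (size A).+1)%N -> 0 < H i.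
Proof.
move=> oi hi; have := conv_height_sign A m d i ltac:(lia) ltac:(lia) hA' hi.
by rewrite /= oi.
Qed.

Let H_even i : ~~ odd i -> (i <= (size A).+1)%N -> H i < 0.
Proof.
move=> oi hi; have := conv_height_sign A m d i ltac:(lia) ltac:(lia) hA' hi.
by rewrite /= (negbTE oi).
Qed.

Lemma coprime_md : coprime m d.
Proof.
rewrite /coprime -dvdn1 -(eqP hbd) dvdn_gcd dvdn_gcdr andbT.
have : (gcdn m d %| a * m + b)%N.
  by apply: (dvdn_trans (dvdn_gcdr m d)); rewrite /dvdn hmod mod0n.
by rewrite dvdn_addr // dvdn_mull // dvdn_gcdl.
Qed.

Lemma dvdz_small (l : int) : - d%:Z < l < d%:Z -> (d%:Z %| l * m%:Z)%Z -> l = 0.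
Proof.
move=> hl; rewrite Gauss_dvdzl; last first.
  by rewrite /coprimez /gcdz /= gcdnC (eqP coprime_md).
move=> /dvdzP[q E]; have [q0|q0] := lerP 1 q; first by nia.
have [q1|q1] := lerP q (-1); first by nia.
by rewrite E (_ : q = 0) ?mul0r //; lia.
Qed.

(** The two forms of [be] give [(a - N s) * m = (kap - K s) * d]. Since [m] is prime to [d] and both
    [a] and [N s] are nonnegative and below [d], they agree. *)
Lemma a_psum : N s = a%:Z /\ K s = kap.
Proof.
have E : (a%:Z - N s) * m%:Z = (kap - K s) * d%:Z.
  by have := be_psum; rewrite -height_psum /be /lattice_height /N /K; lia.
have := psumQ_lt_d (size A) (pquot A) Q erefl erefl QS c_gt0 s (digit D)
  s_le_size digit_le m%:Z d%:Z P erefl erefl PS H_odd H_even.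
rewrite -/N => Nd.
have Ea : a%:Z - N s = 0.
  by apply: dvdz_small; [lia | rewrite E dvdz_mull].
split; first by lia.
by move: E; rewrite Ea mul0r => /esym/eqP; rewrite mulf_eq0 => /orP[/eqP|/eqP]; lia.
Qed.

Let m_bounds : 0 < m%:Z < d%:Z.
Proof. by lia. Qed.

Let be_bounds : 0 <= be < d%:Z.
Proof. by rewrite be_modE; have := @ltn_pmod (a * m) d ltac:(lia); lia. Qed.

Lemma m_neq_be : m%:Z <> be.
Proof.
move=> E; have : (a%:Z - 1) = 0 :> int.
  apply: dvdz_small; first by lia.
  by apply/dvdzP; exists kap; move: E; rewrite /be; lia.
by lia.
Qed.

Let T_odd : odd T.
Proof. by have [k1 _ _ _] := k0P D s hs; rewrite /T; lia. Qed.

Let T_le : (T <= s)%N.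
Proof. by have [k1 k2 _ _] := k0P D s hs; rewrite /T; lia. Qed.

Let b_even0 i : ~~ odd i -> (0 < i < T)%N -> digit D i = 0%N.
Proof.
have [k1 _ k3 _] := k0P D s hs; rewrite /T => oi hi.
have Ei : (2 * i./2 = i)%N by lia.
by have := k3 i./2 ltac:(lia); rewrite Ei.
Qed.

Let b_T1 : (T < s)%N -> (0 < digit D T.+1)%N.
Proof.
have [k1 _ _ k4] := k0P D s hs; rewrite /T => hT.
have -> : (2 * k0 D s).-1.+1 = (2 * k0 D s)%N by lia.
by apply: k4; lia.
Qed.

Lemma classification :
  [/\ forall n k, record_point m%:Z d%:Z a%:Z be n k /\
        d%:Z <= lattice_height m%:Z d%:Z n k <->
        [/\ m%:Z < be, n = 1 & k = -1] \/ low_point (pquot A) Q P T n k,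
      forall n k, record_point m%:Z d%:Z a%:Z be n k /\
        lattice_height m%:Z d%:Z n k < d%:Z <->
        high_point Q s (digit D) P T n k &
      forall n k, low_point (pquot A) Q P T n k -> 1 < n].
Proof.
have [<- _] := a_psum; rewrite be_psum.
apply: (record_classification (size A) (pquot A)) => //.
- exact: s_le_size.
- exact: digit_le.
- exact: digit_zero.
- by rewrite -be_psum.
- by rewrite -be_psum; exact: m_neq_be.
- by rewrite -/N; have [-> _] := a_psum; lia.
Qed.

Let tauE : tauz * d%:Z = a%:Z * m%:Z + b%:Z.
Proof.
have : (d %| a * m + b)%N by rewrite /dvdn hmod mod0n.
by move/divnK; rewrite /tauz /tau; lia.
Qed.

(** By [tauE], [(tauz - kap) * d = be + b], and the residues of [a * m] and [b] sum to [d]; so the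
    quotient is one more than the floor of [b / d]. *)
Lemma abd_E : abd a b d + a%:Z = a%:Z * (tauz - kap).
Proof.
rewrite /abd floor_divn; last by lia.
suff -> : tauz - kap = (b %/ d)%:Z + 1 by ring.
have E1 := divn_eq (a * m) d; have E2 := divn_eq b d; have E3 := mod_sum.
have : (tauz - kap - ((b %/ d)%:Z + 1)) * d%:Z = 0.
  by rewrite !mulrBl tauE /kap; lia.
by move/eqP; rewrite mulf_eq0 => /orP[/eqP|/eqP]; lia.
Qed.

Lemma XE n k : X n k = abd a b d + a%:Z - (tauz * n - a%:Z * k).
Proof. by rewrite abd_E /X /PF_value; ring. Qed.

Lemma X_inj n k n' k' : 1 <= n <= a%:Z -> 1 <= n' <= a%:Z ->
  X n k = X n' k' -> n = n' /\ k = k'.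
Proof. by apply: (PF_value_inj a b d m) => //; lia. Qed.

Lemma muE i : mu a b d m A i = tauz * Q i.+1 - a%:Z * P i.+1.
Proof. by []. Qed.

Lemma sum_mu t : \sum_(1 <= i < t.+1) (digit D i)%:Z * mu a b d m A i.-1
  = tauz * N t - a%:Z * K t.
Proof.
elim: t => [|t IH]; first by rewrite big_geq // /N /K !digit_sum0; ring.
by rewrite big_nat_recr //= IH muE /N /K !digit_sumS; ring.
Qed.

Lemma lt_alpha_beta : (alpha < beta) = (m%:Z < be).
Proof.
rewrite halpha beta_modE be_modE ltr_pM2r ?ltr_nat //.
by rewrite invr_gt0 ltr0n; lia.
Qed.

Lemma F0_E x : F0 a b d m alpha beta x <-> m%:Z < be /\ x = X 1 (-1).
Proof.
by rewrite /F0 /= lt_alpha_beta XE; split=> -[h ->]; split=> //; rewrite /tauz; ring.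
Qed.

(** * Duplicate-free listings of [F1] and [F2] *)

Let low_val (k j : nat) : int :=
  X (Q (2 * k).-1 + j%:Z * Q (2 * k)) (P (2 * k).-1 + j%:Z * P (2 * k) - 1).

Let high_val (k j : nat) : int :=
  X (N (2 * k).-1 + j%:Z * Q (2 * k)) (K (2 * k).-1 + j%:Z * P (2 * k)).

Let low_seq := [seq low_val k j | k <- index_iota 1 (k0 D s),
                                  j <- iota 1 (pquot A (2 * k))].
Let high_seq := [seq high_val k j | k <- index_iota (k0 D s) (s %/ 2).+1,
                                    j <- iota 0 (digit D (2 * k))].

Lemma low_pair_point i l : (0 < i < k0 D s)%N -> (0 < l < 1 + pquot A (2 * i))%N ->
  low_point (pquot A) Q P T (Q (2 * i).-1 + l%:Z * Q (2 * i))
    (P (2 * i).-1 + l%:Z * P (2 * i) - 1).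
Proof.
move=> hi hl; have E : (2 * i).-1.+1 = (2 * i)%N by clear -hi; lia.
by exists (2 * i).-1, l; rewrite E /T; split=> //; clear -hi hl; lia.
Qed.

Lemma high_pair_point i l : (k0 D s <= i < (s %/ 2).+1)%N ->
  (0 <= l < 0 + digit D (2 * i))%N ->
  high_point Q s (digit D) P T (N (2 * i).-1 + l%:Z * Q (2 * i))
    (K (2 * i).-1 + l%:Z * P (2 * i)).
Proof.
have [k1 _ _ _] := k0P D s hs => hi hl.
have E : (2 * i).-1.+1 = (2 * i)%N by clear -k1 hi; lia.
by exists (2 * i).-1, l; rewrite E /T; split=> //; clear -k1 hi hl; lia.
Qed.

Lemma low_seqP x : x \in low_seq <-> F1 a b d m A D s x.
Proof.
have val k j : (0 < k)%N -> abd a b d - mu a b d m A (2 * k - 2)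
              - j%:Z * mu a b d m A (2 * k - 1) = low_val k j.
  move=> k1; rewrite /low_val XE !muE.
  have -> : (2 * k - 2).+1 = (2 * k).-1 by lia.
  have -> : (2 * k - 1).+1 = (2 * k)%N by lia.
  by ring.
split.
  move/allpairsPdep => [k [j [hk hj ->]]]; exists k, j.
  move: hk hj; rewrite mem_index_iota mem_iota => hk hj.
  by split; [lia | lia | rewrite val //; lia].
move=> [k [j [hk hj ->]]]; apply/allpairsPdep; exists k, j.
by rewrite mem_index_iota mem_iota; split; [lia | lia | rewrite val //; lia].
Qed.

Lemma low_seq_point x :
  x \in low_seq <-> exists n k, low_point (pquot A) Q P T n k /\ x = X n k.
Proof.
split.
  move/allpairsPdep => [k [j [hk hj ->]]].
  move: hk hj; rewrite mem_index_iota mem_iota => hk hj.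
  by do 2 eexists; split; [exact: (low_pair_point k j hk hj) | reflexivity].
have [k1 _ _ _] := k0P D s hs.
move=> [n [k [[t [j [ot tT jc -> ->]]] ->]]]; apply/allpairsPdep.
rewrite /T in tT; exists (t.+1)./2, j.
have E : (2 * (t.+1)./2 = t.+1)%N by lia.
by rewrite mem_index_iota mem_iota /low_val E; split=> //; lia.
Qed.

Lemma high_seqP x : x \in high_seq <-> F2 a b d m A D s x.
Proof.
have [k1 k2 k3 _] := k0P D s hs.
have val k j : (0 < k)%N -> abd a b d + a%:Z - j%:Z * mu a b d m A (2 * k - 1)
   - \sum_(1 <= i < (2 * k)%N) (digit D i)%:Z * mu a b d m A i.-1 = high_val k j.
  move=> kk; rewrite /high_val XE muE.
  have -> : (2 * k - 1).+1 = (2 * k)%N by lia.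
  have E : (2 * k).-1.+1 = (2 * k)%N by lia.
  by have := sum_mu (2 * k).-1; rewrite E => ->; ring.
split.
  move/allpairsPdep => [k [j [hk hj ->]]]; exists k, j.
  move: hk hj; rewrite mem_index_iota mem_iota mem_Bset => hk hj.
  by split; [lia | lia | rewrite val //; lia].
move=> [k [j [hk hj ->]]]; apply/allpairsPdep; exists k, j.
rewrite mem_Bset in hk.
(* Even digits before [k0] vanish, so the range from [k0] contains [Bset]; its indices outside
   [Bset] have digit 0 and list nothing. *)
have kk : (k0 D s <= k)%N.
  rewrite leqNgt; apply/negP => lt.
  by have := k3 k ltac:(lia); lia.
by rewrite mem_index_iota mem_iota; split; [lia | lia | rewrite val //; lia].
Qed.

Lemma high_seq_point x : x \in high_seq <->
  exists n k, high_point Q s (digit D) P T n k /\ x = X n k.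
Proof.
split.
  move/allpairsPdep => [k [j [hk hj ->]]].
  move: hk hj; rewrite mem_index_iota mem_iota => hk hj.
  by do 2 eexists; split; [exact: (high_pair_point k j hk hj) | reflexivity].
have [k1 _ _ _] := k0P D s hs.
move=> [n [k [[t [j [ot tT jc -> ->]]] ->]]]; apply/allpairsPdep.
rewrite /T in tT; exists (t.+1)./2, j.
have E : (2 * (t.+1)./2 = t.+1)%N by lia.
by rewrite mem_index_iota mem_iota /high_val E; split=> //; lia.
Qed.

Lemma low_seq_uniq : uniq low_seq.
Proof.
have [_ k2 _ _] := k0P D s hs; have [C1 _ _] := classification.
have sA := s_le_size.
apply: uniq_pairs => [||k j k' j']; [exact: iota_uniq | by move=> k; exact: iota_uniq|].
rewrite !mem_index_iota !mem_iota => hk hj hk' hj'.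
have [[hn _ _] _] := (C1 _ _).2 (or_intror (low_pair_point k j hk hj)).
have [[hn' _ _] _] := (C1 _ _).2 (or_intror (low_pair_point k' j' hk' hj')).
move/X_inj => /(_ hn hn') [En _].
apply: (low_pair_inj (size A) (pquot A) Q erefl erefl QS c_gt0 _ _ _ _ _ _ _ _ _ _ En).
all: by clear -hk hk' hj hj' k2 sA; lia.
Qed.

Lemma high_seq_uniq : uniq high_seq.
Proof.
have [k1 _ _ _] := k0P D s hs; have [_ C2 _] := classification.
apply: uniq_pairs => [||k j k' j']; [exact: iota_uniq | by move=> k; exact: iota_uniq|].
rewrite !mem_index_iota !mem_iota => hk hj hk' hj'.
have [[hn _ _] _] := (C2 _ _).2 (high_pair_point k j hk hj).
have [[hn' _ _] _] := (C2 _ _).2 (high_pair_point k' j' hk' hj').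
move/X_inj => /(_ hn hn') [En _].
apply: (high_pair_inj (size A) (pquot A) Q erefl erefl QS c_gt0 s (digit D)
  s_le_size _ _ _ _ _ _ _ _ _ _ En).
all: by clear -hk hk' hj hj' k1; lia.
Qed.

Lemma size_low_seq : size low_seq = (\sum_(1 <= k < k0 D s) pquot A (2 * k))%N.
Proof.
rewrite size_allpairs_dep sumnE big_map.
by apply: eq_bigr => k _; rewrite size_iota.
Qed.

Lemma size_high_seq : size high_seq =
  (\sum_(k0 D s <= k < (s %/ 2).+1) digit D (2 * k))%N.
Proof.
rewrite size_allpairs_dep sumnE big_map.
by apply: eq_bigr => k _; rewrite size_iota.
Qed.

Lemma F0_F1_disjoint :
  F0 a b d m alpha beta `&` F1 a b d m A D s = set0.
Proof.
have [C1 _ C3] := classification.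
apply/seteqP; split=> // x [/F0_E[mb ->]].
move/low_seqP/low_seq_point => [n [k [lp /X_inj]]].
have [[hn _ _] _] := (C1 n k).2 (or_intror lp).
move=> /(_ ltac:(lia) hn) [En _]; by have := C3 _ _ lp; lia.
Qed.

Lemma low_high_neq n k n' k' : record_point m%:Z d%:Z a%:Z be n k ->
  d%:Z <= lattice_height m%:Z d%:Z n k ->
  high_point Q s (digit D) P T n' k' -> X n k <> X n' k'.
Proof.
have [_ C2 _] := classification.
move=> [hn _ _] hh hp; have [[hn' _ _] hh'] := (C2 n' k').2 hp.
by move/X_inj => /(_ hn hn') [En Ek]; rewrite En Ek in hh; lia.
Qed.

Lemma F0_F2_disjoint : F0 a b d m alpha beta `&` F2 a b d m A D s = set0.
Proof.
have [C1 _ _] := classification.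
apply/seteqP; split=> // x [/F0_E[mb ->]].
move/high_seqP/high_seq_point => [n [k [hp]]].
by have [h1 h2] := (C1 1 (-1)).2 (or_introl (And3 mb erefl erefl)); exact: low_high_neq.
Qed.

Lemma F1_F2_disjoint : F1 a b d m A D s `&` F2 a b d m A D s = set0.
Proof.
have [C1 _ _] := classification.
apply/seteqP; split=> // x [/low_seqP/low_seq_point[n [k [lp ->]]]].
move/high_seqP/high_seq_point => [n' [k' [hp]]].
by have [h1 h2] := (C1 n k).2 (or_intror lp); exact: low_high_neq.
Qed.

(** * The pseudo-Frobenius set and the type in both cases *)

Let S := quot_semigroup (semigroup2 a b) d.

Lemma PF_case1 : (d < b)%N ->
  PF S = F0 a b d m alpha beta `|` F1 a b d m A D s `|` F2 a b d m A D s.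
Proof.
move=> db; have [C1 C2 _] := classification.
rewrite /S (PF_large_b a b d m tauz _ _ _ _ _ kap) -?/be -?/X //; try lia.
apply/seteqP; split=> x /=.
  move=> [n [k [rp ->]]].
  have [hl|hh] := lerP d%:Z (lattice_height m%:Z d%:Z n k); last first.
    right; apply/high_seqP/high_seq_point; exists n, k; split=> //.
    by apply/C2.
  left; have [[mb -> ->]|lp] := (C1 n k).1 (conj rp hl).
    by left; apply/F0_E.
  by right; apply/low_seqP/low_seq_point; exists n, k.
move=> [[/F0_E[mb ->]|/low_seqP/low_seq_point[n [k [lp ->]]]]|].
- exists 1, (-1); split=> //.
  by have [] := (C1 1 (-1)).2 (or_introl (And3 mb erefl erefl)).
- by exists n, k; split=> //; have [] := (C1 n k).2 (or_intror lp).
move=> /high_seqP/high_seq_point[n [k [hp ->]]].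
by exists n, k; split=> //; have [] := (C2 n k).2 hp.
Qed.

Lemma PF_case2 : (b < d)%N -> ~ semigroup2 a b d -> PF S = F2 a b d m A D s.
Proof.
move=> bd hd; have [_ C2 _] := classification.
have Ebe : be = d%:Z - b%:Z.
  by have := mod_sum; rewrite be_modE (modn_small bd); lia.
rewrite /S (PF_small_b a b d m tauz _ _ _ _ _ kap) -?/be -?/X //; try lia.
apply/seteqP; split=> x /=.
  move=> [n [k [rp hh ->]]]; apply/high_seqP/high_seq_point.
  by exists n, k; split=> //; apply/C2.
move=> /high_seqP/high_seq_point[n [k [hp ->]]].
by exists n, k; have [] := (C2 n k).2 hp.
Qed.

Lemma type_case2 : (b < d)%N -> ~ semigroup2 a b d ->
  type_is S (\sum_(k0 D s <= k < (s %/ 2).+1) digit D (2 * k))%N.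
Proof.
move=> bd hd; rewrite /type_is PF_case2 // -size_high_seq.
rewrite (_ : F2 a b d m A D s = [set x | x \in high_seq]).
  by apply: card_uniq_seq; exact: high_seq_uniq.
by apply/seteqP; split=> x /=; move/high_seqP.
Qed.

Lemma type_case1 : (d < b)%N ->
  type_is S (\sum_(1 <= k < k0 D s) pquot A (2 * k)
             + \sum_(k0 D s <= k < (s %/ 2).+1) digit D (2 * k)
             + (alpha < beta)%R)%N.
Proof.
move=> db; rewrite /type_is PF_case1 // -size_low_seq -size_high_seq.
(* The truth value of [alpha < beta], read as 0 or 1, is the number of elements of [F0]. *)
pose u := low_seq ++ high_seq ++ nseq (alpha < beta)%R (X 1 (-1)).
have memF0 x : x \in nseq (alpha < beta)%R (X 1 (-1)) <-> F0 a b d m alpha beta x.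
  rewrite mem_nseq; split; last by move/F0_E => [mb ->]; rewrite lt_alpha_beta mb eqxx.
  move=> /andP[mb /eqP ->]; apply/F0_E; rewrite -lt_alpha_beta.
  by move: mb; case: (alpha < beta)%R.
have -> : (size low_seq + size high_seq + (alpha < beta)%R)%N = size u.
  by rewrite !size_cat size_nseq addnA.
rewrite (_ : _ `|` _ = [set x | x \in u]); last first.
  apply/seteqP; split=> x /=; rewrite !mem_cat.
    case=> [[/memF0 ->|/low_seqP ->]|/high_seqP ->]; by rewrite ?orbT.
  move=> /or3P[/low_seqP h|/high_seqP h|/memF0 h].
  - by left; right.
  - by right.
  - by left; left.
apply: card_uniq_seq; rewrite !cat_uniq low_seq_uniq high_seq_uniq /=.
have disj (U V : set int) x : U `&` V = set0 -> U x -> V x -> False.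
  by move=> UV Ux Vx; have : (U `&` V) x by []; rewrite UV.
apply/and3P; split.
- apply/hasPn => x; rewrite mem_cat => /orP[/high_seqP h|/memF0 h];
    apply/negP => /low_seqP l.
    exact: (disj _ _ x F1_F2_disjoint l h).
  exact: (disj _ _ x F0_F1_disjoint h l).
- apply/hasPn => x /memF0 h; apply/negP => /high_seqP l.
  exact: (disj _ _ x F0_F2_disjoint h l).
by case: (alpha < beta)%R.
Qed.

End Assembly.

Theorem theorem8 (a b d m : nat) (alpha beta : rat) (A D : seq nat) (s : nat)
  (hab : coprime a b) (had : coprime a d) (hbd : coprime b d)
  (hmin : (1 < minn a b < d)%N)
  (hndvd : ~~ (d%:Z %| a%:Z * b%:Z - a%:Z - b%:Z)%Z)
  (hd : ~ semigroup2 a b d)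
  (hm : (1 <= m <= d - 1)%N)
  (hmod : (a * m + b)%N = 0%N %[mod d])
  (halpha : alpha = m%:R / d%:R)
  (hA : is_cf alpha A)
  (hbeta : beta = frac (a%:R * alpha))
  (hD : is_numeration A alpha beta D)
  (hs : last_nonzero D s) :
  let S := quot_semigroup (semigroup2 a b) d in
  let F0 := F0 a b d m alpha beta in
  let F1 := F1 a b d m A D s in
  let F2 := F2 a b d m A D s in
  [/\ beta = 1 - frac (b%:R / d%:R),
      (a < d)%N /\ (d < b)%N ->
        [/\ PF S = F0 `|` F1 `|` F2,
            [/\ F0 `&` F1 = set0, F0 `&` F2 = set0 & F1 `&` F2 = set0] &
            type_is S
              (\sum_(1 <= k < k0 D s) pquot A (2 * k)
               + \sum_(k0 D s <= k < (s %/ 2).+1) digit D (2 * k)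
               + (alpha < beta)%R)%N] &
      (maxn a b < d)%N ->
        PF S = F2 /\
        type_is S (\sum_(k0 D s <= k < (s %/ 2).+1) digit D (2 * k))%N].
Proof.
move=> S F0 F1 F2; split.
- exact: (beta_compl a b d m alpha beta).
- move=> [ad db]; split; [|split|].
  + exact: PF_case1.
  + exact: (F0_F1_disjoint a b d m).
  + exact: (F0_F2_disjoint a b d m).
  + exact: (F1_F2_disjoint a b d m alpha beta).
  + exact: (type_case1 a b d m).
rewrite gtn_max => /andP[ad bd]; split.
  exact: (PF_case2 a b d m alpha beta).
exact: (type_case2 a b d m alpha beta A).
Qed.
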